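(* For every integer $n\ge 1$ there are constants $\mathsf{C}_n,\mathsf{C}'_n>0$, depending only on $n$, such that the following holds. Let $d\ge n$ and $k\ge1$ be integers, and let $F\in\mathbf{S}^k[x_1,\ldots,x_d]$ be a homogeneous polynomial of degree $2n$ in $d$ variables with values in the real symmetric $k\times k$ matrices. Assume that $0\le F(x)\le I$ for all $x\in S^{d-1}$, where $I$ is the identity matrix. Then for every integer $\ell\ge \mathsf{C}_n d$, the polynomial $F+\mathsf{C}'_n\left(\frac{d}{\ell}\right)^2 I$ is $\ell$-sos on $S^{d-1}$.
   Context: $S^{d-1}$ is the unit sphere of $\mathbb{R}^d$. $\mathbf{S}^k$ is the space of real symmetric $k\times k$ matrices and $\mathbf{S}^k[x]$ the space of polynomials in $x=(x_1,\ldots,x_d)$ with coefficients in $\mathbf{S}^k$. Inequalities between symmetric matrices are in the positive semidefinite order. A matrix polynomial $G\in\mathbf{S}^k[x]$ is $\ell$-sos on $S^{d-1}$ if there are finitely many $U_j\in\mathbb{R}^{k\times k}[x]$ with $\deg U_j\le\ell$ such that $G(x)=\sum_j U_j(x)U_j(x)^{\mathsf{T}}$ for all $x\in S^{d-1}$. *)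

(* Defs.v *)
From HB Require Import structures.
From mathcomp Require Import all_boot all_order all_algebra.
From mathcomp Require Import reals.
From mathcomp Require Import mpoly.

Set Implicit Arguments.
Unset Strict Implicit.
Unset Printing Implicit Defensive.

Import Order.TTheory GRing.Theory Num.Theory.
Local Open Scope ring_scope.

(* Points of R^d are functions 'I_d -> R, the form in which [meval] takes them.
   The Euclidean norm is spelled out because the library norm on row vectors is
   the max norm. *)
Definition unit_sphere (R : realType) (d : nat) (x : 'I_d -> R) : Prop :=
  \sum_(i < d) x i ^+ 2 = 1.

Definition mxeval (R : realType) (d k : nat) (F : 'M[{mpoly R[d]}]_k)
  (x : 'I_d -> R) : 'M[R]_k := map_mx (meval x) F.

Definition symmx (T : Type) (k : nat) (A : 'M[T]_k) : Prop := A^T = A.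

(* Symmetry is part of positive semidefiniteness: over the reals it does not
   follow from nonnegativity of the quadratic form. *)
Definition psdmx (R : realType) (k : nat) (A : 'M[R]_k) : Prop :=
  symmx A /\ forall u : 'cV[R]_k, 0 <= (u^T *m A *m u) 0 0.

Definition lemx_psd (R : realType) (k : nat) (A B : 'M[R]_k) : Prop :=
  psdmx (B - A).

(* The zero matrix is homogeneous of every degree. *)
Definition mx_homog (R : realType) (d k m : nat)
  (F : 'M[{mpoly R[d]}]_k) : Prop := forall i j, F i j \is m.-homog.

(* [msize p] is the total degree plus one, and [msize 0 = 0]. *)
Definition mx_deg_le (R : realType) (d k l : nat)
  (U : 'M[{mpoly R[d]}]_k) : Prop := forall i j, (msize (U i j) <= l.+1)%N.

Definition sos_on_sphere (R : realType) (d k l : nat)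
  (G : 'M[{mpoly R[d]}]_k) : Prop :=
  exists Us : seq 'M[{mpoly R[d]}]_k,
    (forall U, U \in Us -> mx_deg_le l U) /\
    (forall x : 'I_d -> R, unit_sphere x ->
       mxeval G x = \sum_(U <- Us) mxeval U x *m (mxeval U x)^T).

(* Main.v *)
Require Import Defs.
From HB Require Import structures.
From mathcomp Require Import boolp classical_sets.
From mathcomp Require Import all_boot all_order all_algebra.
From mathcomp Require Import spectral sesquilinear.
From mathcomp Require Import reals.
From mathcomp Require Import complex.
From mathcomp Require Import mpoly.
From mathcomp Require Import zify ring lra.

Set Implicit Arguments.
Unset Strict Implicit.
Unset Printing Implicit Defensive.

Import Order.TTheory GRing.Theory Num.Theory.
Local Open Scope ring_scope.

(** Averaging a zonal kernel phi(<x,y>) over y in the unit sphere turns a matrix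
    polynomial H which is nonnegative on the sphere into a sum of squares as
    soon as phi is the square of a polynomial q of degree l: the average is a
    finite positive combination of the matrices q(<x,y>)^2 H(y), and a positive
    semidefinite H(y) is a sum of matrices v v^T ([sos_of_positive_mean]).  It
    is therefore enough to write F + delta I as the average of a nonnegative H,
    that is, to invert the operator K : h |-> mean of phi(<x,y>) h(y) on forms
    of degree 2n, and to know that the inverse moves F by at most delta.

    K is close to the identity, uniformly in the dimension.  The reflection
    y' = 2 <x,y> x - y in the line of x preserves both the mean and <x,y>, so
    h(y) may be replaced with (h(y) + h(y')) / 2.  With t = <x,y>, this is the
    even part of the polynomial u |-> h(t x + u z) for a unit vector z
    orthogonal to x; its degree is 2n and it is bounded on [-1,1] by 2^n times
    the maximum of |h| on the sphere, so it differs from h(x) by at most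
    c (1 - t^2) max|h|, where c depends on n only ([reflected_mean_bound]).
    Hence K - 1 has norm at most c eta, with eta the mean of (1 - t^2) phi(t).
    Once c eta <= 1/2, K is injective, hence bijective, on the
    finite-dimensional space of forms of degree 2n ([zonal_endo_surj]), and
    its inverse displaces a form bounded by B by at most 2 c eta B
    ([zonal_inverse_bound]).

    It remains to make eta of order (d/l)^2.  The second derivative q of the
    Gegenbauer polynomial of the largest even degree <= l + 2 does it: its
    differential equation and integration by parts give the exact ratio of
    the means of (1 - t^2) q(t)^2 and q(t)^2 ([gegpoly2_zonal_ratio],
    [zonal_kernel]).

    All integrals are replaced with a positive cubature of the sphere that is
    exact up to a prescribed degree ([sphere_cubature_exists]).  It comes from a
    Gauss quadrature of the Gaussian weight on the line, whose nodes and weights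
    are read off the spectral decomposition of a Jacobi matrix
    ([hermite_quadrature]), by taking products and projecting radially.  The
    only exactness property used afterwards is the Wick recursion for means of
    products of linear forms: it gives the zonal moments, the invariance under
    isometries, and the fact that K maps forms to forms. *)

(** * Gauss quadrature of the Gaussian weight *)

Section HermiteMatrix.
Variables (C : numClosedFieldType) (m : nat).

(* A and its transpose are the truncated ladder operators of the Hermite basis;
   J is then the matrix of multiplication by the variable. *)
Let A : 'M[C]_m.+1 := \matrix_(i, j) (sqrtC j%:R *+ (j == i.+1 :> nat)).
Let J : 'M[C]_m.+1 := A + A^T.
Let e0 : 'rV[C]_m.+1 := delta_mx 0 0.

Lemma mulrA_entry (r : 'rV[C]_m.+1) (j : 'I_m.+1) :
  (r *m A) 0 j = (if j == 0 :> nat then 0 else r 0 (inord j.-1) * sqrtC j%:R).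
Proof.
rewrite mxE; case: ifPn => [/eqP j0 | j_neq0].
  by rewrite big1 // => i _; rewrite mxE j0 mulr0.
have jE : (inord j.-1 : 'I_m.+1) = j.-1 :> nat.
  by rewrite inordK // (leq_ltn_trans (leq_pred _)).
rewrite (bigD1 (inord j.-1)) //= mxE jE prednK ?lt0n // eqxx mulr1n.
rewrite big1 ?addr0 // => i ne; rewrite mxE; case: eqP => [jS|]; last by rewrite mulr0.
by case/eqP: ne; apply/val_inj; rewrite /= jE jS.
Qed.

Lemma mulrAT_entry (r : 'rV[C]_m.+1) (j : 'I_m.+1) :
  (r *m A^T) 0 j = (if j == m :> nat then 0 else r 0 (inord j.+1) * sqrtC j.+1%:R).
Proof.
rewrite mxE; case: ifPn => [/eqP jm | j_neqm].
  rewrite big1 // => i _; rewrite !mxE jm; case: eqP => [im|]; last by rewrite mulr0.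
  by have := ltn_ord i; rewrite im ltnn.
have jltm : (j.+1 < m.+1)%N by have := ltn_ord j; rewrite !ltnS leq_eqVlt (negPf j_neqm).
have jE : (inord j.+1 : 'I_m.+1) = j.+1 :> nat by rewrite inordK.
rewrite (bigD1 (inord j.+1)) //= !mxE jE eqxx mulr1n.
rewrite big1 ?addr0 // => i ne; rewrite !mxE; case: eqP => [jS|]; last by rewrite mulr0.
by case/eqP: ne; apply/val_inj; rewrite /= jE jS.
Qed.

(** The canonical commutation relation [A, A^T] = 1 fails in the last
    coordinate only, because of the truncation. *)
Lemma hermite_commutator (r : 'rV[C]_m.+1) : r 0 ord_max = 0 ->
  r *m J *m A^T = r *m A^T *m J + r.
Proof.
move=> rmax; rewrite /J !mulmxDr mulmxDl addrAC; congr (_ + _).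
apply/rowP=> j; rewrite mulrAT_entry [RHS]mxE !mulrA_entry mulrAT_entry.
have sq i : sqrtC i%:R * sqrtC i%:R = i%:R :> C by rewrite -expr2 sqrtCK.
have jlt := ltn_ord j; rewrite ltnS in jlt.
have predm : (j == 0 :> nat) = false -> (j.-1 == m :> nat) = false.
  by move=> j0; rewrite ltn_eqF // (leq_trans _ jlt) // prednK // lt0n j0.
case: (eqVneq (j : nat) m) => [jm|jm].
  have rj : r 0 j = 0 by rewrite -[RHS]rmax; congr (r _ _); apply/val_inj.
  case: ifP => [_|j0]; first by rewrite add0r.
  rewrite inordK ?(leq_ltn_trans (leq_pred _)) // predm //.
  by rewrite prednK ?lt0n ?j0 // inord_val rj !mul0r add0r.
have jm' : (j < m)%N by rewrite ltn_neqAle jm.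
rewrite inordK ?ltnS //= inord_val -mulrA sq.
case: ifP => [/eqP ->|j0]; first by rewrite add0r mulr1.
rewrite inordK ?(leq_ltn_trans (leq_pred _)) //.
rewrite predm // prednK ?lt0n ?j0 //.
by rewrite inord_val -mulrA sq -natr1 mulrDr mulr1.
Qed.

Lemma hermite_support k (j : 'I_m.+1) : (k < j)%N -> (e0 *m J ^+ k) 0 j = 0.
Proof.
elim: k j => [|k IH] j kj.
  by rewrite expr0 mulmx1 mxE eqxx /= -val_eqE /= gtn_eqF.
rewrite exprSr mulmxA mulmxDr mxE mulrA_entry mulrAT_entry.
have jlt := ltn_ord j; rewrite ltnS in jlt.
have -> : (j == 0 :> nat) = false by rewrite gtn_eqF // (leq_trans _ kj).
rewrite IH ?mul0r ?add0r; last first.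
  by rewrite inordK ?(leq_ltn_trans (leq_pred _)) // -ltnS prednK // (leq_trans _ kj).
case: ifP => // jm; rewrite IH ?mul0r // inordK.
  by rewrite -2!ltnS; apply: ltnW (ltnW kj).
by rewrite ltnS ltn_neqAle jm.
Qed.

(** The lowering operator acts on polynomials in J applied to the vacuum
    vector as differentiation; the truncation is invisible up to degree m
    by [hermite_support]. *)
Lemma hermite_lowering k : (k <= m)%N -> 
  e0 *m J ^+ k *m A^T = k%:R *: (e0 *m J ^+ k.-1).
Proof.
elim: k => [_|k IH km].
  rewrite expr0 mulmx1 scale0r; apply/rowP=> j; rewrite mulrAT_entry !mxE.
  case: ifP => // jm; rewrite eqxx -val_eqE /= inordK ?mul0r //.
  by rewrite ltnS ltn_neqAle jm -ltnS ltn_ord.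
rewrite exprSr mulmxA hermite_commutator; last by rewrite hermite_support.
rewrite IH ?(ltnW km) // -scalemxAl -mulmxA -[J ^+ _ *m J]/(J ^+ _ * J) -exprSr.
case: k {IH} km => [|k] _; first by rewrite scale0r add0r scale1r.
by rewrite /= -[in RHS]natr1 scalerDl scale1r.
Qed.

(** Stein's identity: the vacuum expectations of the powers of J are the
    moments of the standard Gaussian law, as long as the degree is at most m. *)
Lemma hermite_moment k : (k <= m)%N ->
  (e0 *m J ^+ k.+1) 0 0 = k%:R * (e0 *m J ^+ k.-1) 0 0.
Proof.
move=> km; rewrite exprSr mulmxA mulmxDr hermite_lowering // mxE mulrA_entry /=.
by rewrite add0r mxE.
Qed.

(** The spectral measure of J at the vacuum vector: the nodes are the
    eigenvalues, the weights the squared moduli of the first coordinates of the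
    eigenvectors, which is why they are nonnegative. *)
Lemma hermite_spectral : exists w t : 'I_m.+1 -> C,
  [/\ forall i, 0 <= w i, forall i, t i \is Num.real &
     forall k, (e0 *m J ^+ k) 0 0 = \sum_i w i * t i ^+ k].
Proof.
have Jherm : J \is hermsymmx.
  apply: realsym_hermsym.
    by apply/is_hermitianmxP; rewrite expr0 scale1r map_mx_id // /J linearD /= trmxK addrC.
  apply/mxOverP => i j; rewrite !mxE ger0_real //.
  by rewrite addr_ge0 // mulrn_wge0 // sqrtC_ge0 ler0n.
set P := spectralmx J; set D := spectral_diag J.
have Dreal : D \is a realmx by apply: hermitian_spectral_diag_real.
have JE : J = invmx P *m diag_mx D *m P.
  by apply/orthomx_spectralP/hermitian_normalmx.
have Punit : P \in unitmx by apply: spectral_unit.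
have Punitary : P \is unitarymx by apply: spectral_unitarymx.
have JkE k : J ^+ k = invmx P *m diag_mx (\row_i D 0 i ^+ k) *m P.
  elim: k => [|k IH].
    rewrite expr0 (_ : \row_i _ = const_mx 1); last by apply/rowP=> i; rewrite !mxE expr0.
    by rewrite diag_const_mx mulmx1 mulVmx.
  rewrite exprSr IH -[_ * J]/(_ *m J) {1}JE -!mulmxA mulKVmx //; congr (_ *m _).
  rewrite !mulmxA mulmx_diag; congr (diag_mx _ *m _).
  by apply/rowP=> i; rewrite !mxE exprSr.
exists (fun i => (P i 0)^* * P i 0), (fun i => D 0 i); split.
- by move=> i; rewrite mulrC mul_conjC_ge0.
- by move=> i; apply: (mxOverP Dreal).
move=> k; rewrite JkE invmx_unitary //.
rewrite -rowE mxE mxE; apply: eq_bigr => i _.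
rewrite mul_mx_diag !mxE mulrAC; congr (_ * _ * _).
Qed.

End HermiteMatrix.

(** Exactness is expressed by Stein's recursion on moments, which is the only
    form in which it is used. *)
Lemma hermite_quadrature (R : realType) (m : nat) :
  exists w t : 'I_m.+1 -> R,
  [/\ forall i, 0 <= w i, \sum_i w i = 1 &
    forall k, (k <= m)%N ->
      \sum_i w i * t i ^+ k.+1 = k%:R * \sum_i w i * t i ^+ k.-1].
Proof.
have [w [t [w0 treal wt]]] := hermite_spectral (complex.complex R) m.
have wE i : exists x : R, w i = complex.real_complex R x.
  exact/complex.complex_realP/ger0_real.
have tE i : exists x : R, t i = complex.real_complex R x.
  exact/complex.complex_realP.
have wRE i : w i = complex.real_complex R (complex.Re (w i)) by have [x ->] := wE i.
have tRE i : t i = complex.real_complex R (complex.Re (t i)) by have [x ->] := tE i.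
have sE k : complex.real_complex R (\sum_i complex.Re (w i) * complex.Re (t i) ^+ k)
    = \sum_i w i * t i ^+ k.
  rewrite rmorph_sum; apply: eq_bigr => i _.
  by rewrite [in RHS]wRE [in RHS]tRE rmorphM rmorphXn.
exists (fun i => complex.Re (w i)), (fun i => complex.Re (t i)); split.
- by move=> i; have := w0 i; rewrite wRE complex.ler0c.
- apply: (@complex.complexI R).
  transitivity (\sum_i w i * t i ^+ 0).
    rewrite -sE; congr (complex.real_complex _ _); apply: eq_bigr => i _.
    by rewrite expr0 mulr1.
  by rewrite -wt expr0 mulmx1 mxE !eqxx rmorph1.
move=> k km; apply: (@complex.complexI R).
by rewrite rmorphM sE -wt hermite_moment // wt -sE rmorph_nat.
Qed.

(** * Linear forms and products of linear forms *)

Lemma homog_msize_le (R : nzRingType) d e (p : {mpoly R[d]}) : p \is e.-homog -> (msize p <= e.+1)%N.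
Proof.
move=> /dhomogP hp; rewrite msizeE big_seq; apply: (big_ind (fun n => n <= e.+1)%N) => //.
  by move=> a b ae be; rewrite geq_max ae.
by move=> mm /hp ->.
Qed.

Section LinearForms.
Variables (R : comNzRingType) (d : nat).
Implicit Types (u v x y : 'I_d -> R) (vs : seq ('I_d -> R)).

Definition dotv u v : R := \sum_i u i * v i.

Definition linform v : {mpoly R[d]} := \sum_i v i *: 'X_i.

Definition del_nth k vs := take k vs ++ drop k.+1 vs.

Lemma dotvC u v : dotv u v = dotv v u.
Proof. by apply: eq_bigr => i _; rewrite mulrC. Qed.

Lemma meval_linform v x : (linform v).@[x] = dotv v x.
Proof. by rewrite /linform raddf_sum /=; apply: eq_bigr => i _; rewrite mevalZ mevalXU. Qed.

Lemma linform_homog v : linform v \is 1.-homog.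
Proof. by apply: rpred_sum => i _; rewrite rpredZ // dhomogX /= mdeg1. Qed.

Lemma mderiv_linform i v : (linform v)^`M(i) = (v i)%:MP.
Proof.
rewrite /linform raddf_sum /= (bigD1 i) //= big1 => [|j ji]; last first.
  by rewrite mderivZ mderivX mnm1E (negPf ji) scale0r scaler0.
by rewrite mderivZ mderivX mnm1E eqxx scale1r -{1}[U_(i)%MM]add0m addmK mpolyX0 addr0 -mul_mpolyC mulr1.
Qed.

Lemma size_del_nth k vs : (k < size vs)%N -> size (del_nth k vs) = (size vs).-1.
Proof.
move=> ks; rewrite size_cat size_takel ?(ltnW ks) // size_drop.
by case: (size vs) ks => // n kn; rewrite subSS subnKC.
Qed.

Lemma map_del_nth (f : ('I_d -> R) -> 'I_d -> R) k vs :
  del_nth k (map f vs) = map f (del_nth k vs).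
Proof. by rewrite /del_nth map_cat map_take map_drop. Qed.

Lemma prod_linform_homog vs : \prod_(v <- vs) linform v \is (size vs).-homog.
Proof.
elim: vs => [|v vs IH]; first by rewrite big_nil dhomog1.
by rewrite big_cons -[size _]/(1 + size vs)%N dhomogM // linform_homog.
Qed.

Lemma mderiv_prod_linform i vs :
  (\prod_(v <- vs) linform v)^`M(i) =
  \sum_(k < size vs) nth (fun=> 0) vs k i *: \prod_(v <- del_nth k vs) linform v.
Proof.
elim: vs => [|v vs IH]; first by rewrite big_nil big_ord0 mderivC.
rewrite big_cons mderivM mderiv_linform IH big_ord_recl mul_mpolyC; congr (_ + _).
  by rewrite /del_nth /= drop0.
rewrite mulr_sumr; apply: eq_bigr => k _.
by rewrite /del_nth /= big_cons -scalerAr.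
Qed.

Definition evec (i : 'I_d) : 'I_d -> R := fun j => (j == i)%:R.

Lemma dotv_evecl i v : dotv (evec i) v = v i.
Proof.
rewrite /dotv (bigD1 i) //= big1 => [|j ji]; rewrite /evec ?eqxx ?mul1r ?addr0 //.
by rewrite (negPf ji) mul0r.
Qed.

Lemma dotvZr c u v : dotv u (fun i => c * v i) = c * dotv u v.
Proof. by rewrite /dotv mulr_sumr; apply: eq_bigr => i _; rewrite mulrCA. Qed.

Lemma prod_del_nth k vs (F : ('I_d -> R) -> R) : (k < size vs)%N ->
  F (nth (fun=> 0) vs k) * \prod_(v <- del_nth k vs) F v = \prod_(v <- vs) F v.
Proof.
move=> ks; rewrite -[in RHS](cat_take_drop k vs) (drop_nth (fun=> 0) ks) /del_nth.
by rewrite !big_cat big_cons /= mulrCA.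
Qed.

End LinearForms.

Section UnitVectors.
Variables (R : realType) (d : nat).
Implicit Types (x z : 'I_d -> R).

Lemma unit_sphereE x : unit_sphere x <-> dotv x x = 1.
Proof.
by rewrite /unit_sphere /dotv; split=> <-; apply: eq_bigr => i _; rewrite expr2.
Qed.

Lemma dotvv_ge0 z : 0 <= dotv z z.
Proof. by apply: sumr_ge0 => i _; rewrite -expr2 sqr_ge0. Qed.

Lemma dotvv_eq0 z : dotv z z = 0 -> forall i, z i = 0.
Proof.
move=> z0 i; apply/eqP; rewrite -sqrf_eq0; apply/eqP.
move/eqP: z0; rewrite /dotv psumr_eq0 => [/allP/(_ i)|j _]; last by rewrite -expr2 sqr_ge0.
by rewrite mem_index_enum => /(_ isT) /eqP.
Qed.

End UnitVectors.

(** * Gaussian means in several variables *)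

Section Gaussian.
Variables (R : realType) (d m : nat).
Variables (w t : 'I_m.+1 -> R).
Hypothesis w_stein : forall k, (k <= m)%N ->
      \sum_i w i * t i ^+ k.+1 = k%:R * \sum_i w i * t i ^+ k.-1.

Let I := {ffun 'I_d -> 'I_m.+1}.
Definition pnode (a : {ffun 'I_d -> 'I_m.+1}) (i : 'I_d) : R := t (a i).
Definition pweight (a : {ffun 'I_d -> 'I_m.+1}) : R := \prod_i w (a i).
Let E (p : {mpoly R[d]}) : R := \sum_(a : I) pweight a * p.@[pnode a].
Let mu k := \sum_i w i * t i ^+ k.

Lemma pmeanZ c p : E (c *: p) = c * E p.
Proof. by rewrite /E mulr_sumr; apply: eq_bigr => a _; rewrite mevalZ mulrCA. Qed.

Lemma pmean_sum (T : Type) (s : seq T) (P : pred T) F :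
  E (\sum_(j <- s | P j) F j) = \sum_(j <- s | P j) E (F j).
Proof. by rewrite /E exchange_big; apply: eq_bigr => a _; rewrite raddf_sum mulr_sumr. Qed.

Lemma pmeanX (al : 'X_{1..d}) : E 'X_[al] = \prod_i mu (al i).
Proof.
rewrite /mu bigA_distr_bigA /=; apply: eq_bigr => a _.
by rewrite mevalX -big_split.
Qed.

(** Both sides factor over the coordinates of a monomial, and only the i-th
    factor differs, so that the one-dimensional recursion is enough. *)
Lemma pmean_stein i (p : {mpoly R[d]}) : (msize p <= m.+1)%N -> E ('X_i * p) = E p^`M(i).
Proof.
move=> pm; rewrite [p]mpolyE mulr_sumr raddf_sum /= !pmean_sum.
apply: eq_big_seq => al alp; rewrite -scalerAr mderivZ !pmeanZ; congr (_ * _).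
have alm : (al i <= m)%N.
  rewrite -ltnS (leq_trans _ pm) // (leq_ltn_trans _ (msize_mdeg_lt alp)) //.
  by rewrite mdegE (bigD1 i) //= leq_addr.
rewrite -mpolyXD mderivX pmeanZ !pmeanX !(bigD1 i (P := predT)) //= !mulrA; congr (_ * _).
  by rewrite mnmDE mnmBE mnm1E eqxx add1n subn1 /mu w_stein.
by apply: eq_bigr => j ji; rewrite mnmDE mnmBE mnm1E eq_sym (negPf ji) add0n subn0.
Qed.

(** Stein's identity contracted with v: differentiating the product along v
    removes the factors one at a time. *)
Lemma pmean_wick (v : 'I_d -> R) vs : (size vs <= m)%N ->
  E (linform v * \prod_(u <- vs) linform u) =
  \sum_(k < size vs) dotv v (nth (fun=> 0) vs k) * E (\prod_(u <- del_nth k vs) linform u).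
Proof.
move=> sm; rewrite /linform mulr_suml pmean_sum.
transitivity (\sum_i v i * E (\prod_(u <- vs) linform u)^`M(i)).
  apply: eq_bigr => i _; rewrite -scalerAl pmeanZ pmean_stein //.
  by rewrite (leq_trans (homog_msize_le (prod_linform_homog vs))).
transitivity (\sum_i \sum_(k < size vs) v i *
    E (nth (fun=> 0) vs k i *: \prod_(u <- del_nth k vs) linform u)).
  apply: eq_bigr => i _; rewrite mderiv_prod_linform pmean_sum.
  by rewrite mulr_sumr.
rewrite exchange_big /=; apply: eq_bigr => k _.
rewrite /dotv mulr_suml; apply: eq_bigr => i _.
by rewrite pmeanZ mulrA.
Qed.

End Gaussian.


(** * Positive cubature of the sphere *)

Section SphereFromGauss.
Variables (R : realType) (d M : nat).
Variables (w t : 'I_(2 * M).+1 -> R).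
Hypothesis w_ge0 : forall i, 0 <= w i.
Hypothesis w_sum : \sum_i w i = 1.
Hypothesis w_stein : forall k, (k <= 2 * M)%N ->
      \sum_i w i * t i ^+ k.+1 = k%:R * \sum_i w i * t i ^+ k.-1.

Let I := {ffun 'I_d -> 'I_(2 * M).+1}.
Let y (a : I) : 'I_d -> R := pnode t a.
Let G (r : nat) (vs : seq ('I_d -> R)) : R :=
  \sum_(a : I) pweight w a * (dotv (y a) (y a) ^+ r * \prod_(v <- vs) dotv v (y a)).

Lemma gmean_wick v vs : (size vs <= 2 * M)%N ->
  G 0 (v :: vs) = \sum_(k < size vs) dotv v (nth (fun=> 0) vs k) * G 0 (del_nth k vs).
Proof.
move=> sv; have := pmean_wick w_stein v sv.
have GE us : \sum_(a : I) pweight w a * (\prod_(u <- us) linform u).@[pnode t a] = G 0 us.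
  apply: eq_bigr => a _; rewrite expr0 mul1r rmorph_prod /=; congr (_ * _).
  by apply: eq_bigr => u _; rewrite meval_linform.
have := GE (v :: vs); rewrite big_cons => -> ->.
by apply: eq_bigr => k _; rewrite GE.
Qed.

(** Wick's recursion applied to |y|^2 = sum_i <e_i,y>^2: pairing the two copies
    of e_i gives d, and pairing the first one with a factor of the product
    restores that factor. *)
Lemma gmean_norm2 vs : ((size vs).+1 <= 2 * M)%N ->
  \sum_i G 0 (evec R i :: evec R i :: vs) = (d + size vs)%:R * G 0 vs.
Proof.
move=> sv.
under eq_bigr do rewrite gmean_wick // big_ord_recl /=.
rewrite big_split natrD mulrDl /=; congr (_ + _).
  rewrite (eq_bigr (fun=> G 0 vs)); last first.
    move=> i _; rewrite dotv_evecl /evec eqxx mul1r.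
    by rewrite /del_nth /= drop0.
  by rewrite sumr_const card_ord mulr_natl.
rewrite exchange_big /= (eq_bigr (fun=> G 0 vs)); last first.
  move=> k _; rewrite /G.
  under eq_bigr do rewrite mulr_sumr.
  rewrite exchange_big /=; apply: eq_bigr => a _.
  rewrite expr0 mul1r -(prod_del_nth (fun v => dotv v (y a)) (ltn_ord k)) /=.
  transitivity (\sum_i pweight w a * (nth (fun=> 0) vs k i * y a i * \prod_(v <- del_nth k vs) dotv v (y a))).
    apply: eq_bigr => i _; rewrite mul1r dotv_evecl /del_nth /= big_cons dotv_evecl.
    by rewrite -!mulrA mulrCA.
  by rewrite -mulr_sumr -mulr_suml.
by rewrite sumr_const card_ord mulr_natl.
Qed.

(* Ratio of the Gaussian means of |y|^(2r) f and f, for f homogeneous of degree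
   q: the radial part of the Gaussian integral. *)
Let K q r : R := \prod_(j < r) (d + q + 2 * j)%:R.

Lemma gmean_radial r vs : (2 * r + size vs <= 2 * M)%N -> G r vs = K (size vs) r * G 0 vs.
Proof.
elim: r vs => [|r IH] vs rs; first by rewrite /K big_ord0 mul1r.
have -> : G r.+1 vs = \sum_i G r (evec R i :: evec R i :: vs).
  rewrite exchange_big /=; apply: eq_bigr => a _.
  rewrite -mulr_sumr; congr (_ * _); rewrite exprSr {2}/dotv -mulrA mulr_suml mulr_sumr.
  by apply: eq_bigr => i _; rewrite !big_cons !dotv_evecl !mulrA.
rewrite (eq_bigr (fun i => K (size vs).+2 r * G 0 (evec R i :: evec R i :: vs))); last first.
  by move=> i _; rewrite IH //= addnS addnS; move: rs; rewrite mulnS.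
rewrite -mulr_sumr gmean_norm2; last first.
  by move: rs; rewrite mulnS; clear; move: (size vs) => s; lia.
rewrite mulrA; congr (_ * _); rewrite /K big_ord_recl muln0 addn0 mulrC; congr (_ * _).
by apply: eq_bigr => j _; congr (_%:R); rewrite /= /bump /=; lia.
Qed.

Hypotheses (d_gt0 : (0 < d)%N) (M_gt0 : (0 < M)%N).

Let e0 : 'I_d -> R := evec R (Ordinal d_gt0).
(* A node at the origin has weight 0 as M > 0; it is sent to an arbitrary unit
   vector so that every node lies on the sphere. *)
Let node (a : I) : 'I_d -> R := let N := dotv (y a) (y a) in
  if N == 0 then e0 else fun i => (Num.sqrt N)^-1 * y a i.
Let weight (a : I) : R := pweight w a * dotv (y a) (y a) ^+ M / K 0 M.

Lemma radial_const_gt0 q r : 0 < K q r.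
Proof. by apply: prodr_gt0 => j _; rewrite ltr0n !addn_gt0 d_gt0. Qed.

(** For a product of 2m linear forms, the factor |y|^(2M) of the weight leaves
    |y|^(2(M-m)) after radial projection; evenness of the degree keeps the
    radial factor polynomial, hence exactly integrated. *)
Lemma smeanE m vs : size vs = (2 * m)%N -> (m <= M)%N ->
  \sum_a weight a * \prod_(v <- vs) dotv v (node a) =
  (K (2 * m) (M - m) / K 0 M) * G 0 vs.
Proof.
move=> sv mM.
transitivity ((K 0 M)^-1 * G (M - m) vs); last first.
  rewrite gmean_radial ?sv; last by rewrite -mulnDr subnK.
  by rewrite mulrA; congr (_ * _); rewrite mulrC.
rewrite /G mulr_sumr; apply: eq_bigr => a _.
suff H : dotv (y a) (y a) ^+ M * \prod_(v <- vs) dotv v (node a) =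
    dotv (y a) (y a) ^+ (M - m) * \prod_(v <- vs) dotv v (y a).
  by rewrite -H /weight; ring.
rewrite /node; case: (eqVneq (dotv (y a) (y a)) 0) => [N0|N0].
  rewrite N0 expr0n (gtn_eqF M_gt0) mul0r expr0n.
  case: (eqVneq (M - m)%N 0%N) => [Mm|]; last by rewrite mul0r.
  rewrite mul1r.
  case: vs sv => [|v vs] sv.
    by move: Mm M_gt0; case: m sv {mM} => // _; rewrite subn0 => ->.
  rewrite big_cons; suff -> : dotv v (y a) = 0 by rewrite mul0r.
  by rewrite /dotv big1 // => i _; rewrite (dotvv_eq0 N0) mulr0.
have -> : \prod_(v <- vs) dotv v (fun i => (Num.sqrt (dotv (y a) (y a)))^-1 * y a i)
  = dotv (y a) (y a) ^- m * \prod_(v <- vs) dotv v (y a).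
  under eq_bigr do rewrite dotvZr.
  rewrite big_split /= big_const_seq (eq_count (a2 := predT)) // count_predT sv iter_mulr_1.
  by rewrite exprM exprVn sqr_sqrtr ?dotvv_ge0 // exprVn.
by rewrite -{1}(subnK mM) exprD -!mulrA mulVKf ?expf_neq0.
Qed.

(** Wick's recursion on the sphere: the ratio of the radial constants of two
    consecutive even degrees produces the factor d + size vs - 1. *)
Lemma sphere_from_gauss : 
 [/\ forall a, 0 <= weight a, forall a, unit_sphere (node a), \sum_a weight a = 1 &
  forall v vs, odd (size vs) -> (size vs < 2 * M)%N ->
   (d + (size vs).-1)%:R * \sum_a weight a * \prod_(u <- v :: vs) dotv u (node a)
   = \sum_(k < size vs) dotv v (nth (fun=> 0) vs k) *
       \sum_a weight a * \prod_(u <- del_nth k vs) dotv u (node a)].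
Proof.
split.
- move=> a; rewrite !mulr_ge0 ?invr_ge0 ?(ltW (radial_const_gt0 _ _)) ?exprn_ge0 ?dotvv_ge0 //.
  by apply: prodr_ge0.
- move=> a; rewrite /unit_sphere /node; case: (eqVneq (dotv (y a) (y a)) 0) => [N0|N0].
    have := dotv_evecl (Ordinal d_gt0) e0; rewrite /e0 {3}/evec eqxx /dotv => h.
    by rewrite -[RHS]h; apply: eq_bigr => i _; rewrite expr2.
  under eq_bigr do rewrite exprMn.
  rewrite -mulr_sumr exprVn sqr_sqrtr ?dotvv_ge0 //.
  rewrite (_ : \sum_i _ = dotv (y a) (y a)) ?mulVf //.
- have := smeanE (m := 0) (vs := [::]) erefl isT.
  under eq_bigr do rewrite big_nil mulr1.
  rewrite muln0 subn0 divff ?gt_eqF ?radial_const_gt0 // mul1r => ->.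
  rewrite /G; under eq_bigr do rewrite big_nil expr0 !mulr1.
  by rewrite /pweight -(bigA_distr_bigA (fun _ : 'I_d => w)) /= big1.
move=> v vs vs_odd vsM.
pose m := (size vs)./2.
have szE : size vs = (2 * m).+1 by rewrite -[LHS]odd_double_half vs_odd mul2n.
have mM : (m < M)%N by rewrite -(@ltn_pmul2l 2) //; apply: ltnW; rewrite -szE.
rewrite (@smeanE m.+1) //; last by rewrite /= szE mulnS.
rewrite gmean_wick; last exact: ltnW.
rewrite mulrA mulr_sumr; apply: eq_bigr => k _; rewrite mulrCA; congr (_ * _).
rewrite (@smeanE m) ?(ltnW mM) //; last by rewrite size_del_nth // szE.
congr (_ * _); rewrite mulrA; congr (_ / _).
rewrite szE /= /K -(subnSK mM) big_ord_recl muln0 addn0; congr (_ * _).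
by apply: eq_bigr => j _; congr (_%:R); rewrite /= /bump /=; lia.
Qed.

End SphereFromGauss.

Definition smean (R : realType) (d : nat) (I : finType) (w : I -> R)
  (y : I -> 'I_d -> R) (vs : seq ('I_d -> R)) : R :=
  \sum_a w a * \prod_(u <- vs) dotv u (y a).

(** The last clause characterizes the uniform probability on the sphere up to
    degree 2M on products of an even number of linear forms. *)
Definition sphere_cubature (R : realType) (d M : nat) (I : finType)
  (w : I -> R) (y : I -> 'I_d -> R) : Prop :=
 [/\ forall a, 0 <= w a, forall a, unit_sphere (y a), \sum_a w a = 1 &
  forall v vs, odd (size vs) -> (size vs < 2 * M)%N ->
   (d + (size vs).-1)%:R * smean w y (v :: vs)
   = \sum_(k < size vs) dotv v (nth (fun=> 0) vs k) * smean w y (del_nth k vs)].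

Lemma sphere_cubature_exists (R : realType) (d M : nat) : (0 < d)%N -> (0 < M)%N ->
  exists (I : finType) (w : I -> R) (y : I -> 'I_d -> R), sphere_cubature M w y.
Proof.
move=> d0 M0; have [w [t [w0 w1 wS]]] := hermite_quadrature R (2 * M).
have h := sphere_from_gauss w0 w1 wS d0 M0.
by do 3! eexists; exact: h.
Qed.

(** * Means of zonal polynomials *)

Section ZonalMean.
Variables (R : realType) (d : nat).

(** Moments of <x,y> for y uniform on the unit sphere of R^d, that is of the
    weight (1 - t^2)^((d-3)/2) on [-1,1] when d > 1. *)
Fixpoint zmom (k : nat) : R :=
  match k with
  | 0 => 1
  | 1 => 0
  | j.+2 => j.+1%:R / (d + j)%:R * zmom j
  end.

Lemma zmomSS k : zmom k.+2 = k.+1%:R / (d + k)%:R * zmom k.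
Proof. by []. Qed.

Definition zmean (p : {poly R}) : R := \sum_(k < size p) p`_k * zmom k.

Implicit Types p q f g : {poly R}.

Lemma zmean_widen N p : (size p <= N)%N -> zmean p = \sum_(k < N) p`_k * zmom k.
Proof.
move=> pN; rewrite /zmean (big_ord_widen _ (fun k => p`_k * zmom k) pN) big_mkcond.
by apply: eq_bigr => k _; case: ltnP => // kp; rewrite nth_default // mul0r.
Qed.

Lemma zmeanD p q : zmean (p + q) = zmean p + zmean q.
Proof.
pose N := maxn (size p) (size q).
rewrite !(@zmean_widen N) ?leq_maxl ?leq_maxr ?size_polyD // -big_split /=.
by apply: eq_bigr => k _; rewrite coefD mulrDl.
Qed.

Lemma zmeanZ c p : zmean (c *: p) = c * zmean p.
Proof.
rewrite !(@zmean_widen (size p)) ?size_scale_leq // mulr_sumr.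
by apply: eq_bigr => k _; rewrite coefZ mulrA.
Qed.

Lemma zmeanN p : zmean (- p) = - zmean p.
Proof. by rewrite -scaleN1r zmeanZ mulN1r. Qed.

Lemma zmeanB p q : zmean (p - q) = zmean p - zmean q.
Proof. by rewrite zmeanD zmeanN. Qed.

Lemma zmean_sum (T : Type) (s : seq T) (F : T -> {poly R}) :
  zmean (\sum_(j <- s) F j) = \sum_(j <- s) zmean (F j).
Proof.
elim: s => [|j s IH]; rewrite ?big_nil ?big_cons ?zmeanD ?IH //.
by rewrite /zmean size_poly0 big_ord0.
Qed.

Lemma zmean0 : zmean 0 = 0.
Proof. by rewrite /zmean size_poly0 big_ord0. Qed.

Lemma zmeanXn k : zmean 'X^k = zmom k.
Proof.
rewrite (@zmean_widen k.+1) ?size_polyXn // big_ord_recr /= big1 => [|j _].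
  by rewrite coefXn eqxx mul1r add0r.
by rewrite coefXn ltn_eqF ?mul0r.
Qed.

Lemma zmom_odd k : odd k -> zmom k = 0.
Proof.
suff H : zmom (2 * k./2).+1 = 0 by move=> ok; rewrite -(odd_double_half k) ok -mul2n.
elim: (k./2) => // j IH.
by rewrite mulnS zmomSS IH mulr0.
Qed.

Hypothesis d_gt0 : (0 < d)%N.
Let nu : R := d%:R - 1.
Let s : {poly R} := 1 - 'X^2.

(** Integration by parts against the weight (1 - t^2)^((nu-2)/2). *)
Lemma zmean_ibp f : nu * zmean ('X * f) = zmean (s * f^`()).
Proof.
have XfE : 'X * f = \sum_(k < size f) f`_k *: 'X^(k.+1).
  rewrite -{1}[f]coefK poly_def mulr_sumr; apply: eq_bigr => k _.
  by rewrite -scalerAr exprS.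
have sfE : s * f^`() = \sum_(k < size f) f`_k *: (k%:R *: (s * 'X^(k.-1))).
  rewrite -{1}[f]coefK poly_def raddf_sum mulr_sumr; apply: eq_bigr => k _.
  by rewrite /= derivZ derivXn -scalerAr mulrnAr -scaler_nat.
rewrite XfE sfE !zmean_sum (big_distrr nu) /=; apply: eq_bigr => k _.
rewrite !zmeanZ mulrCA zmeanXn; congr (_ * _).
case: (nat_of_ord k) => [|j]; first by rewrite /= mulr0 mul0r.
have -> : s * 'X^j = 'X^j - 'X^(j.+2) by rewrite /s mulrBl mul1r -exprD.
rewrite zmeanB !zmeanXn zmomSS.
have : d%:R + j%:R != 0 :> R by rewrite -natrD pnatr_eq0 -lt0n addn_gt0 d_gt0.
by rewrite /nu natrD -natr1 => ?; field.
Qed.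

(** In the Wick recursion for a power of <x,y> all contractions are equal
    to <x,x> = 1, which is the recursion of [zmom]. *)
Lemma sphere_moment M (I : finType) (w : I -> R) y (x : 'I_d -> R) k :
  sphere_cubature M w y -> unit_sphere x -> ~~ odd k -> (k <= 2 * M)%N ->
  \sum_a w a * dotv x (y a) ^+ k = zmom k.
Proof.
move=> [w0 y1 w1 wick] x1.
have LE j : smean w y (nseq j x) = \sum_a w a * dotv x (y a) ^+ j.
  by apply: eq_bigr => a _; rewrite big_nseq iter_mulr_1.
have xx : dotv x x = 1 by rewrite -[RHS]x1; apply: eq_bigr => i _; rewrite expr2.
move=> ko; rewrite -(odd_double_half k) (negPf ko) add0n -mul2n.
elim: (k./2) => [_|j IH jM].
  by under eq_bigr do rewrite expr0 mulr1.
have j2 : (2 * j.+1)%N = (2 * j).+2 by lia.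
rewrite j2 zmomSS in jM *.
have := wick x (nseq (2 * j).+1 x); rewrite size_nseq /= mul2n odd_double -mul2n => /(_ isT).
rewrite -[x :: x :: _]/(nseq (2 * j).+2 x) LE.
have delE (i : 'I_(2 * j).+1) : del_nth i (nseq (2 * j).+1 x) = nseq (2 * j) x.
  rewrite /del_nth take_nseq ?(ltnW (ltn_ord i)) // drop_nseq -nseqD.
  by congr (nseq _ x); have := ltn_ord i; lia.
have jM' : (2 * j <= 2 * M)%N by lia.
rewrite (eq_bigr (fun=> zmom (2 * j))) => [H|i _]; last first.
  by rewrite delE LE IH // -[x :: _]/(nseq (2 * j).+1 x) nth_nseq ltn_ord xx mul1r.
have {}H := H ltac:(lia).
have dj : (d + 2 * j)%:R != 0 :> R by rewrite pnatr_eq0 -lt0n addn_gt0 d_gt0.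
rewrite mulrAC; apply: (canRL (mulfK dj)).
by rewrite mulrC; apply: etrans H _; rewrite sumr_const card_ord mulr_natl.
Qed.

Lemma sphere_dotv_bound (x y : 'I_d -> R) : unit_sphere x -> unit_sphere y ->
  -1 <= dotv x y <= 1.
Proof.
move=> x1 y1.
have h c : c ^+ 2 = 1 -> 0 <= 2 + 2 * c * dotv x y.
  move=> c2; rewrite (_ : _ + _ = \sum_i (x i + c * y i) ^+ 2).
    by apply: sumr_ge0 => i _; rewrite sqr_ge0.
  under [RHS]eq_bigr do rewrite sqrrD exprMn c2 mul1r mulrCA -mulr_natr.
  rewrite !big_split /= x1 y1 -!mulr_suml -mulr_sumr /dotv; ring.
have := h 1 ltac:(ring); have := h (-1) ltac:(ring); lra.
Qed.

(** The mean is a combination with positive weights of the values of the even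
    part of g at scalar products of unit vectors. *)
Lemma zmean_ge0 g : (forall t : R, -1 <= t <= 1 -> 0 <= g.[t]) -> 0 <= zmean g.
Proof.
move=> g0; pose x : 'I_d -> R := evec R (Ordinal d_gt0).
have x1 : unit_sphere x.
  have := dotv_evecl (Ordinal d_gt0) x; rewrite {2}/x /evec eqxx => h.
  by rewrite /unit_sphere -[RHS]h; apply: eq_bigr => i _; rewrite expr2.
have [I [w [y cub]]] := @sphere_cubature_exists R d (size g).+1 d_gt0 isT.
have [w0 y1 w1 _] := cub.
suff -> : zmean g = 2^-1 * \sum_a w a * (g.[dotv x (y a)] + g.[- dotv x (y a)]).
  rewrite mulr_ge0 ?invr_ge0 // sumr_ge0 // => a _; rewrite mulr_ge0 //.
  have := sphere_dotv_bound x1 (y1 a) => b.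
  by rewrite addr_ge0 // g0 //; lra.
transitivity (\sum_(k < size g) g`_k * (2^-1 * \sum_a w a * (dotv x (y a) ^+ k + (- dotv x (y a)) ^+ k))).
  apply: eq_bigr => k _; congr (_ * _).
  case: (boolP (odd k)) => ok.
    rewrite zmom_odd // big1 ?mulr0 // => a _.
    by rewrite [(- _) ^+ k]exprNn -signr_odd ok expr1 mulN1r subrr mulr0.
  rewrite -(sphere_moment cub x1 ok); last by have := ltn_ord k; lia.
  rewrite mulr_sumr; apply: eq_bigr => a _.
  by rewrite [(- _) ^+ k]exprNn -signr_odd (negPf ok) expr0 mul1r; field.
under eq_bigr do rewrite mulrCA mulr_sumr.
rewrite -mulr_sumr exchange_big /=; congr (_ * _); apply: eq_bigr => a _.
under eq_bigr do rewrite mulrCA.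
rewrite -mulr_sumr !horner_coef -big_split /=; congr (_ * _).
by apply: eq_bigr => k _; rewrite mulrDr.
Qed.

End ZonalMean.

(** * A concentrated zonal kernel from Gegenbauer polynomials *)

Section Gegenbauer.
Variables (R : realType) (d : nat).
Hypothesis d_gt1 : (1 < d)%N.
Let d_gt0 : (0 < d)%N := ltnW d_gt1.
Let nu : R := d%:R - 1.
Let s : {poly R} := 1 - 'X^2.
Let e := @zmean R d.
Implicit Types f g : {poly R}.

Lemma zmeanCM c f : e (c%:P * f) = c * e f.
Proof. by rewrite mul_polyC /e zmeanZ. Qed.

Lemma deriv_s : s^`() = - (2 * 'X).
Proof. by rewrite /s derivB derivXn derivC /= sub0r expr1 mulr_natl. Qed.

Lemma nu_gt0 : 0 < nu.
Proof. by rewrite /nu subr_gt0 ltr1n. Qed.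

Lemma zmean_s_gt0 k : 0 < e (s ^+ k).
Proof.
elim: k => [|k IH]; first by rewrite expr0 /e -(expr0 'X) zmeanXn ltr01.
have := zmean_ibp d_gt0 ('X * s ^+ k).
rewrite -/s -/nu -/e.
have -> : s * ('X * s ^+ k)^`() = s ^+ k.+1 - (2 * k%:R)%:P * ('X^2 * s ^+ k).
  rewrite derivM derivX deriv_exp deriv_s mul1r mulrDr -exprS; congr (_ + _).
  case: k {IH} => [|k]; first by rewrite !mulr0n !mulr0 polyC0 mul0r oppr0.
  by rewrite /= (exprS s) -mulr_natr polyCM !polyC_natr; ring.
have -> : 'X * ('X * s ^+ k) = s ^+ k - s ^+ k.+1 by rewrite (exprS s) /s; ring.
have -> : 'X^2 * s ^+ k = s ^+ k - s ^+ k.+1 by rewrite (exprS s) /s; ring.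
rewrite /e !zmeanB mul_polyC zmeanZ zmeanB -/e => H.
have nk : 0 < nu + 2 * k%:R by rewrite ltr_wpDr ?nu_gt0 // mulr_ge0.
have {}H : (nu + 2 * k%:R) * e (s ^+ k) = (1 + (nu + 2 * k%:R)) * e (s ^+ k.+1) by lra.
by rewrite -(pmulr_rgt0 _ (addr_gt0 ltr01 nk)) -H mulr_gt0.
Qed.

(** Integration by parts passes the hypothesis from f to its derivative, at the
    cost of one more factor 1 - t^2; this reduces to constants, for which
    [zmean_s_gt0] concludes. *)
Lemma zmean_nondegenerate n k f : (size f <= n)%N ->
  (forall g, e (s ^+ k * f * g) = 0) -> f = 0.
Proof.
elim: n k f => [|n IH] k f fn ef; first by apply/eqP; rewrite -size_poly_leq0.
have f'0 : f^`() = 0.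
  apply: (IH k.+1) => [|g].
    case: (eqVneq f 0) => [->|fnz]; first by rewrite deriv0 size_poly0.
    by rewrite -ltnS (leq_trans (lt_size_deriv fnz)).
  have := zmean_ibp d_gt0 (s ^+ k * f * g); rewrite -/s -/nu -/e.
  have -> : 'X * (s ^+ k * f * g) = s ^+ k * f * ('X * g) by ring.
  rewrite ef mulr0 => /esym.
  have -> : s * (s ^+ k * f * g)^`() =
     s ^+ k.+1 * f^`() * g + s ^+ k * f * (s * g^`() - (2 * k%:R)%:P * ('X * g)).
    rewrite !derivM deriv_exp deriv_s.
    case: k {ef} => [|k]; first by rewrite !mulr0n !expr0 !mulr0 polyC0 expr1; ring.
    by rewrite /= !(exprS s) -mulr_natr polyCM !polyC_natr; ring.
  by rewrite /e zmeanD -/e ef addr0.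
have fC : f = (f`_0)%:P.
  apply/polyP => -[|i]; rewrite coefC //=; apply/eqP.
  by have /polyP/(_ i)/eqP := f'0; rewrite coef_deriv coef0 mulrn_eq0.
have := ef 1; rewrite mulr1 fC mulrC zmeanCM => /eqP.
by rewrite mulf_eq0 (gt_eqF (zmean_s_gt0 k)) orbF => /eqP ->.
Qed.

(** By the Cauchy-Schwarz argument, a polynomial whose square has mean 0 is
    orthogonal to every polynomial. *)
Lemma zmean_sqr_gt0 f : f != 0 -> 0 < e (f ^+ 2).
Proof.
have pos g : 0 <= e (g ^+ 2) by apply: zmean_ge0 => // t _; rewrite horner_exp sqr_ge0.
move=> fnz; rewrite lt_def pos andbT; apply: contra fnz => /eqP f0; apply/eqP.
apply: (@zmean_nondegenerate (size f) 0) => // g; rewrite expr0 mul1r.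
have H (c : R) : 0 <= 2 * c * e (f * g) + c ^+ 2 * e (g ^+ 2).
  have := pos (f + c%:P * g).
  have -> : (f + c%:P * g) ^+ 2 = f ^+ 2 + ((2 * c)%:P * (f * g) + (c ^+ 2)%:P * g ^+ 2).
    by rewrite !polyCM polyC_natr; ring.
  by rewrite /e zmeanD -/e f0 add0r /e zmeanD -/e !zmeanCM.
(* Any negative multiple of E small enough would do; 1 + Q avoids the case Q = 0. *)
have Q0 := pos g; have := H (- e (f * g) / (1 + e (g ^+ 2))).
set E := e (f * g); set Q := e (g ^+ 2) in Q0 *.
have Q1 : 0 < 1 + Q by lra.
have -> : 2 * (- E / (1 + Q)) * E + (- E / (1 + Q)) ^+ 2 * Q =
  - (E ^+ 2 * ((2 + Q) / (1 + Q) ^+ 2)) by field; lra.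
rewrite oppr_ge0 pmulr_lle0; last by rewrite divr_gt0 ?exprn_gt0 //; lra.
by move=> E2; apply/eqP; rewrite -sqrf_eq0 eq_le E2 sqr_ge0.
Qed.

Variable l0 : nat.
Hypotheses (l0_gt1 : (1 < l0)%N) (l0_even : ~~ odd l0).
(* La is the eigenvalue of the Gegenbauer operator on polynomials of degree l0,
   and La1 the one attached to the derivatives of its eigenvectors. *)
Let La : R := l0%:R * (l0%:R + nu - 1).
Let La1 : R := La - nu.

(** Coefficients of the even solution with value 1 at 0 of the Gegenbauer
    equation; the series stops at degree l0 because the numerator of the
    recursion vanishes there. *)
Fixpoint gegcoef (k : nat) : R :=
  match k with
  | 0 => 1
  | 1 => 0
  | j.+2 => (j%:R * (j%:R + nu - 1) - La) / (j.+1%:R * j.+2%:R) * gegcoef j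
  end.

Arguments gegcoef : simpl never.

Lemma gegcoefE j : gegcoef j.+2 =
  (j%:R * (j%:R + nu - 1) - La) / (j.+1%:R * j.+2%:R) * gegcoef j.
Proof. by []. Qed.

Lemma gegcoefSS k :
  k.+1%:R * k.+2%:R * gegcoef k.+2 = (k%:R * (k%:R + nu - 1) - La) * gegcoef k.
Proof.
by rewrite gegcoefE mulrA mulrCA divff ?mulr1 // mulf_neq0 ?pnatr_eq0.
Qed.

Lemma gegcoef_odd k : odd k -> gegcoef k = 0.
Proof.
suff H : gegcoef (2 * k./2).+1 = 0 by move=> ok; rewrite -(odd_double_half k) ok -mul2n.
elim: (k./2) => // j IH.
by rewrite mulnS gegcoefE IH mulr0.
Qed.

Lemma gegcoef_big k : (l0 < k)%N -> gegcoef k = 0.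
Proof.
suff H j : gegcoef (l0 + j).+1 = 0 /\ gegcoef (l0 + j).+2 = 0.
  by move=> lk; have := (H (k - l0.+1)%N).1; rewrite -addSn subnKC.
elim: j => [|j [IH1 IH2]].
  by rewrite addn0 gegcoef_odd // gegcoefE /La subrr !mul0r.
by rewrite addnS; split => //; rewrite gegcoefE IH1 mulr0.
Qed.

Definition gegpoly : {poly R} := \poly_(k < l0.+1) gegcoef k.

Lemma coef_gegpoly k : gegpoly`_k = gegcoef k.
Proof. by rewrite coef_poly; case: ltnP => // lk; rewrite gegcoef_big. Qed.

Let P0 := gegpoly.
Let P1 := P0^`().
Let P2 := P1^`().
Let P3 := P2^`().

Lemma coef_deriv_natl f i : f^`()`_i = i.+1%:R * f`_i.+1.
Proof. by rewrite coef_deriv mulr_natl. Qed.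

Lemma gegpoly_ode : s * P2 = nu%:P * ('X * P1) - La%:P * P0.
Proof.
apply/polyP => k.
rewrite /s mulrBl mul1r !(coefB, coefCM) coefXnM coefXM /P2 /P1 !coef_deriv_natl.
rewrite /P0 !coef_gegpoly.
have /= := gegcoefSS k.
case: k => [|[|k]] /=.
- by rewrite mul0r !mulr1 => H; lra.
- by move=> H; lra.
rewrite -[(k.+2 - 2)%N]/(k - 0)%N subn0.
by move=> H; lra.
Qed.

Lemma gegpoly_ode' : s * P3 = (nu + 2)%:P * ('X * P2) - La1%:P * P1.
Proof.
have := congr1 (@deriv R) gegpoly_ode.
rewrite derivB !derivM !derivC derivX deriv_s -/P1 -/P2 -/P3 => H.
rewrite /La1 polyCB polyCD !polyC_natr.
have -> : s * P3 = (- (2 * 'X) * P2 + s * P3) + 2 * 'X * P2 by ring.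
by rewrite H; ring.
Qed.

Lemma La_gap k : (k < l0)%N -> k%:R * (k%:R + nu - 1) < La.
Proof.
move=> kl; have n0 := nu_gt0.
have l1 : (k%:R + 1 <= l0%:R :> R) by rewrite natr1 ler_nat.
have l2 : (2 <= l0%:R :> R) by rewrite ler_nat.
have k0 : (0 <= k%:R :> R) by [].
rewrite /La; nra.
Qed.

(** The operator f |-> (1 - t^2) f'' - nu t f' is symmetric for the mean, and its
    eigenvalues in degrees below l0 differ from that of [gegpoly]. *)
Lemma gegpoly_orthXn k : (k < l0)%N -> e (P0 * 'X^k) = 0.
Proof.
have sym f : e ((s * P2 - nu%:P * ('X * P1)) * f) = e (P0 * (s * f^`()^`() - nu%:P * ('X * f^`()))).
  have A1 := zmean_ibp d_gt0 (P1 * f).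
  have A2 := zmean_ibp d_gt0 (P0 * f^`()).
  move: A1 A2; rewrite -/s -/nu -/e !derivM -/P1 -/P2 => A1 A2.
  have -> : (s * P2 - nu%:P * ('X * P1)) * f =
    s * (P2 * f + P1 * f^`()) - s * (P1 * f^`()) - nu%:P * ('X * (P1 * f)) by ring.
  have -> : P0 * (s * f^`()^`() - nu%:P * ('X * f^`())) =
    s * (P1 * f^`() + P0 * f^`()^`()) - s * (P1 * f^`()) - nu%:P * ('X * (P0 * f^`())) by ring.
  by rewrite /e !zmeanB -/e !zmeanCM A1 A2; lra.
have eig f : e (P0 * (s * f^`()^`() - nu%:P * ('X * f^`()))) = - La * e (P0 * f).
  rewrite -sym gegpoly_ode -zmeanCM; congr e; rewrite polyCN; ring.
have neq k' : (k' < l0)%N -> k'%:R * (k'%:R + nu - 1) - La != 0.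
  by move=> kl; rewrite subr_eq0 lt_eqF // La_gap.
elim/ltn_ind: k => k IH kl.
have := eig 'X^k; have := neq _ kl; move: IH kl.
case: k => [|[|k]] IH kl nz.
- rewrite expr0 !derivC !mulr0 subrr !mulr0 /e zmean0 -/e => /esym/eqP.
  by rewrite mulf_eq0 -sub0r -[0 - La]addr0 ; move: nz; rewrite mul0r => /negPf; rewrite addr0 => -> /eqP.
- rewrite expr1 derivX derivC mulr0 sub0r mulr1.
  have -> : P0 * - (nu%:P * 'X) = (- nu)%:P * (P0 * 'X) by rewrite polyCN; ring.
  rewrite zmeanCM => H; apply: (mulfI nz); lra.
have e0 : e (P0 * 'X^k) = 0 by apply: IH; lia.
have -> : ('X^(k.+2) : {poly R})^`()^`() = (k.+2%:R * k.+1%:R)%:P * 'X^k.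
  by rewrite derivXn derivMn derivXn -mulrnA -natrM polyC_natr mulr_natl [in RHS]mulnC.
have -> : ('X^(k.+2) : {poly R})^`() = (k.+2%:R)%:P * 'X^(k.+1).
  by rewrite derivXn /= -mulr_natr polyC_natr mulrC.
have -> : P0 * (s * ((k.+2%:R * k.+1%:R)%:P * 'X^k) - nu%:P * ('X * (k.+2%:R%:P * 'X^(k.+1)))) =
  (k.+2%:R * k.+1%:R)%:P * (P0 * 'X^k) + (- (k.+2%:R * (k.+1%:R + nu)))%:P * (P0 * 'X^(k.+2)).
  rewrite polyCN !polyCM polyCD !exprS /s; ring.
rewrite /e zmeanD -/e !zmeanCM e0 => H; apply: (mulfI nz).
rewrite -(natr1 k.+1) in H *; lra.
Qed.

Lemma gegpoly_orth f : (size f <= l0)%N -> e (P0 * f) = 0.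
Proof.
move=> fl; rewrite -[f]coefK poly_def mulr_sumr /e zmean_sum big1 // => k _.
by rewrite -scalerAr zmeanZ -/e gegpoly_orthXn ?mulr0 // (leq_trans (ltn_ord k)).
Qed.

Lemma size_gegpoly2 : (size P2 <= l0.-1)%N.
Proof.
apply/leq_sizeP => j lj; rewrite /P2 /P1 !coef_deriv coef_gegpoly gegcoef_big ?mul0rn //.
by lia.
Qed.

Lemma gegpoly2_neq0 : P2 != 0.
Proof.
apply/eqP => /polyP/(_ 0%N); rewrite /P2 /P1 !coef_deriv_natl coef_gegpoly coef0 => H.
have a0 : gegcoef 0 = 1 by [].
have := gegcoefSS 0; have := La_gap (ltnW l0_gt1); rewrite a0 !mul0r mulr1 => gap S.
by move: gap; rewrite -oppr_lt0 -sub0r -S -mulrA H ltxx.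
Qed.

(** With P1, P2, P3 the derivatives, put Y = E(s P2^2), X = E(t^2 P2^2),
    T = E(t P1 P2), U = E(s t P2 P3).  The equation for P0 times P2 and
    orthogonality give Y = nu T; integration by parts of t P2^2 gives
    nu X = Y + 2 U; the equation for P1 times t P2 gives
    (nu + 2) X = U + La1 T.  Eliminating T and U leaves the ratio of Y to
    X + Y = E(P2^2). *)
Lemma gegpoly2_zonal_ratio :
  (2 * La1 + nu ^+ 2 + 3 * nu) * e (s * P2 ^+ 2) = nu * (nu + 4) * e (P2 ^+ 2).
Proof.
set Y := e (s * P2 ^+ 2); pose X := e ('X * ('X * P2 ^+ 2)).
pose T := e ('X * P1 * P2); pose U := e (s * 'X * P2 * P3).
have W : e (P2 ^+ 2) = X + Y.
  by rewrite /X /Y /e -zmeanD; congr (zmean d); rewrite /s; ring.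
have H1 : Y = nu * T.
  rewrite /Y; have -> : s * P2 ^+ 2 = (s * P2) * P2 by ring.
  rewrite gegpoly_ode; have -> : (nu%:P * ('X * P1) - La%:P * P0) * P2 =
    nu%:P * ('X * P1 * P2) - La%:P * (P0 * P2) by ring.
  rewrite /e zmeanB -/e !zmeanCM gegpoly_orth ?mulr0 ?subr0 //.
  by rewrite (leq_trans size_gegpoly2) ?leq_pred.
have H2 : nu * X = Y + 2 * U.
  have := zmean_ibp d_gt0 ('X * P2 ^+ 2); rewrite -/s -/nu -/e -/X => ->.
  rewrite /Y /U -zmeanCM /e -zmeanD; congr (zmean d).
  by rewrite derivM derivX deriv_exp -/P3 /= expr1 -mulr_natr !polyC_natr; ring.
have H3 : (nu + 2) * X = U + La1 * T.
  rewrite /X /U /T -!zmeanCM /e -zmeanD; congr (zmean d).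
  have -> : s * 'X * P2 * P3 = (s * P3) * ('X * P2) by ring.
  by rewrite gegpoly_ode'; ring.
rewrite W.
have H4 : (nu + 4) * X = 2 * La1 * T - Y by lra.
have -> : nu * (nu + 4) * (X + Y) = nu * ((nu + 4) * X) + nu * (nu + 4) * Y by ring.
rewrite H4; transitivity (2 * La1 * (nu * T) - nu * Y + nu * (nu + 4) * Y); last by ring.
by rewrite -H1; ring.
Qed.

End Gegenbauer.

(** On the two-point sphere (d = 1) the weight 1 - t^2 vanishes and q = 1 works.
    Otherwise q is the normalized second derivative of the Gegenbauer polynomial
    of the largest even degree l0 <= l + 2, and La1 = (l0 - 1)(l0 + nu) >= l^2. *)
Lemma zonal_kernel (R : realType) (d l : nat) : (0 < d)%N -> (0 < l)%N ->
  exists q : {poly R}, [/\ (size q <= l.+1)%N, forall k, odd k -> q`_k = 0,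
    zmean d (q ^+ 2) = 1 & zmean d ((1 - 'X^2) * q ^+ 2) <= 2 * (d%:R / l%:R) ^+ 2].
Proof.
move=> d0 l_gt0; have l0R : (0 < l%:R :> R) by rewrite ltr0n.
have z1 : zmean d (1 : {poly R}) = 1 by rewrite -(expr0 'X) zmeanXn.
case: (ltngtP d 1) => [|d1|d1]; first by lia.
  pose l0 := (2 * (l./2).+1)%N.
  have ol0 : ~~ odd l0 by rewrite /l0 mul2n odd_double.
  have ll0 : (l.+1 <= l0 <= l.+2)%N by have := odd_double_half l; rewrite /l0; lia.
  have l01 : (1 < l0)%N by rewrite /l0; lia.
  set P := (gegpoly R d l0)^`()^`().
  have ratio := gegpoly2_zonal_ratio R d1 l01 ol0; rewrite -/P in ratio.
  have W0 : 0 < zmean d (P ^+ 2) by apply: zmean_sqr_gt0 => //; apply: gegpoly2_neq0.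
  have Y0 : 0 <= zmean d ((1 - 'X^2) * P ^+ 2).
    apply: zmean_ge0 => // t /andP[t1 t2]; rewrite hornerM horner_exp mulr_ge0 ?sqr_ge0 //.
    by rewrite !hornerE; nra.
  pose c := (Num.sqrt (zmean d (P ^+ 2)))^-1.
  have c2 : c ^+ 2 = (zmean d (P ^+ 2))^-1 by rewrite exprVn sqr_sqrtr // ltW.
  exists (c *: P); split.
  - rewrite (leq_trans (size_scale_leq _ _)) // (leq_trans (size_gegpoly2 _ _ _ _)) //; lia.
  - move=> k ok; rewrite coefZ !coef_deriv coef_gegpoly // gegcoef_odd //=; first by rewrite !mul0rn mulr0.
    by rewrite negbK.
  - by rewrite exprZn zmeanZ c2 mulVf // gt_eqF.
  rewrite exprZn -scalerAr zmeanZ c2 mulrC ler_pdivrMr //.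
  set Y := zmean d ((1 - 'X^2) * P ^+ 2) in ratio Y0 *; set W := zmean d (P ^+ 2) in ratio W0 *.
  have dR : (2 <= d%:R :> R) by rewrite ler_nat.
  have l0l : (l%:R + 1 <= l0%:R :> R) by rewrite natr1 ler_nat; lia.
  set D : R := d%:R in ratio dR *; set L : R := l%:R in l0R l0l *.
  set N : R := l0%:R in ratio l0l *.
  rewrite (_ : 2 * (D / L) ^+ 2 * W = (2 * D ^+ 2 * W) / L ^+ 2); last first.
    by rewrite exprMn exprVn; ring.
  rewrite ler_pdivlMr ?exprn_gt0 //.
  have La1E : L ^+ 2 <= N * (N + (D - 1) - 1) - (D - 1) by nra.
  have DE : (D - 1) * (D - 1 + 4) <= 4 * D ^+ 2 by nra.
  have A : 2 * L ^+ 2 * Y <= 4 * D ^+ 2 * W.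
    apply: le_trans (_ : (D - 1) * (D - 1 + 4) * W <= _); last by rewrite ler_wpM2r // ltW.
    by rewrite -ratio ler_wpM2r //; nra.
  lra.
rewrite {}d1 in d0 z1 *; exists 1; rewrite size_poly1 expr1n mulr1 z1; split => //.
  by case=> // k _; rewrite coef1.
by rewrite zmeanB z1 zmeanXn zmomSS /= addn0 divff ?oner_eq0 // mulr1 subrr mulr_ge0 ?sqr_ge0.
Qed.

(** * Evaluation of forms along lines *)

(** Lagrange interpolation at N + 1 points of [0,1]. *)
Lemma coef_bound (R : realType) (N : nat) : exists2 c : R, 0 <= c &
  forall (p : {poly R}) (B : R), (size p <= N.+1)%N ->
    (forall u : R, -1 <= u <= 1 -> `|p.[u]| <= B) -> forall i, `|p`_i| <= c * B.
Proof.
pose x (i : nat) : R := i%:R / N.+1%:R.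
have x_inj : injective x.
  by move=> i j /(mulIf _) -/(_ _)/eqP; rewrite eqr_nat => H; apply/eqP/H; rewrite invr_eq0 pnatr_eq0.
pose Lg (i : 'I_N.+1) : {poly R} := tnth (lagrange N.+1 x) i.
exists (\sum_(i < N.+1) \sum_(k < N.+1) `|(Lg i)`_k|).
  by apply: sumr_ge0 => i _; apply: sumr_ge0.
move=> p B sp pB k.
have B0 : 0 <= B by apply: le_trans (pB 0 _); rewrite ?normr_ge0 // lerN10 ler01.
case: (ltnP k N.+1) => [kN|kN]; last first.
  rewrite nth_default ?(leq_trans sp) // normr0 mulr_ge0 //.
  by apply: sumr_ge0 => i _; apply: sumr_ge0.
rewrite [in leLHS](lagrange_gen (isT : (0 < N.+1)%N) x_inj sp) coef_sum mulr_suml.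
apply: le_trans (ler_norm_sum _ _ _) _; apply: ler_sum => i _.
rewrite coefCM normrM mulrC ler_pM //.
  by rewrite (bigD1 (Ordinal kN)) //= lerDl; apply: sumr_ge0.
apply: pB; rewrite /x; have := ltn_ord i => iN.
rewrite (le_trans (lerN10 _)) ?divr_ge0 //= ler_pdivrMr ?ltr0n // mul1r ler_nat.
exact: ltnW.
Qed.

Lemma even_part_bound (R : realType) (N : nat) : exists2 c : R, 0 <= c &
  forall (p : {poly R}) (B : R), (size p <= N.+1)%N ->
    (forall u : R, -1 <= u <= 1 -> `|p.[u]| <= B) ->
  forall s : R, 0 <= s <= 1 -> `|(p.[s] + p.[- s]) / 2 - p.[0]| <= c * B * s ^+ 2.
Proof.
have [c c0 cP] := coef_bound R N.
exists (c * N%:R); first by rewrite mulr_ge0.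
move=> p B sp pB s /andP[s0 s1].
have B0 : 0 <= B by apply: le_trans (pB 0 _); rewrite ?normr_ge0 // lerN10 ler01.
have -> : (p.[s] + p.[- s]) / 2 - p.[0] = \sum_(k < N) p`_k.+1 * ((s ^+ k.+1 + (- s) ^+ k.+1) / 2).
  rewrite !(horner_coef_wide _ sp) !big_ord_recl !expr0 !mulr1.
  rewrite [X in _ - (_ + X)]big1 => [|k _]; last by rewrite exprS mul0r mulr0.
  have -> : forall a b b' : R, (a + b + (a + b')) / 2 - (a + 0) = (b + b') / 2 by move=> *; field.
  rewrite -big_split /= mulr_suml; apply: eq_bigr => k _.
  by rewrite -mulrDr mulrA.
apply: le_trans (ler_norm_sum _ _ _) _.
have -> : c * N%:R * B * s ^+ 2 = \sum_(k < N) c * B * s ^+ 2.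
  by rewrite sumr_const card_ord -mulr_natr; ring.
apply: ler_sum => k _; rewrite normrM ler_pM ?cP //.
case: (nat_of_ord k) => [|j].
  by rewrite !expr1 subrr mul0r normr0 sqr_ge0.
rewrite normrM (ger0_norm (_ : 0 <= 2^-1)) ?invr_ge0 // ler_pdivrMr //.
rewrite (le_trans (ler_normD _ _)) // !normrX normrN (ger0_norm s0) mulr_natr mulr2n.
have : s ^+ j.+2 <= s ^+ 2 by rewrite ler_wiXn2l // s0.
lra.
Qed.

Section LinePolynomial.
Variables (R : realType) (d : nat).
Implicit Types (h : {mpoly R[d]}) (a z : 'I_d -> R).

Definition linepoly h a z : {poly R} :=
  \sum_(m <- msupp h) h@_m *: \prod_i ((a i)%:P + z i *: 'X) ^+ m i.

Lemma horner_linepoly h a z u : (linepoly h a z).[u] = h.@[fun i => a i + u * z i].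
Proof.
rewrite mevalE /linepoly horner_sum; apply: eq_bigr => m _.
rewrite hornerZ horner_prod; congr (_ * _); apply: eq_bigr => i _.
by rewrite horner_exp !hornerE mulrC.
Qed.

Lemma size_linepoly e h a z : h \is e.-homog -> (size (linepoly h a z) <= e.+1)%N.
Proof.
move=> /dhomogP hh; apply: (leq_trans (size_sum _ _ _)).
rewrite big_seq; apply: (big_ind (fun n => n <= e.+1)%N) => //.
  by move=> p q pe qe; rewrite geq_max pe.
move=> m mh; rewrite (leq_trans (size_scale_leq _ _)) //.
rewrite (leq_trans (size_prod_leq _ _)) // leq_subLR.
have -> : #|'I_d| = (\sum_(i < d) 1)%N by rewrite sum1_card.
rewrite -(hh _ mh) /= mdegE addnS ltnS -big_split /=.
apply: leq_sum => i _; apply: leq_trans (size_exp_leq _ _) _.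
rewrite add1n ltnS -[leqRHS]mul1n leq_mul2r; apply/orP; right.
by rewrite -subn1 leq_subLR (leq_trans (size_polyD _ _)) // geq_max
  (leq_trans (size_polyC_leq1 _)) //= (leq_trans (size_scale_leq _ _)) // size_polyX.
Qed.

Lemma meval_homogZ e h c a : h \is e.-homog -> h.@[fun i => c * a i] = c ^+ e * h.@[a].
Proof.
move=> /dhomogP hh; rewrite !mevalE mulr_sumr; apply: eq_big_seq => m mh.
rewrite mulrCA; congr (_ * _); rewrite -(hh _ mh) /= mdegE -prodrXr -big_split /=.
by apply: eq_bigr => i _; rewrite exprMn.
Qed.

Lemma homog_bound n h S a : (0 < n)%N -> h \is (2 * n).-homog ->
  (forall x, unit_sphere x -> `|h.@[x]| <= S) -> `|h.@[a]| <= S * dotv a a ^+ n.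
Proof.
move=> n0 hh hS; have aE : dotv a a = \sum_i a i ^+ 2 by apply: eq_bigr => i _; rewrite expr2.
case: (eqVneq (dotv a a) 0) => [a0|anz].
  have -> : h.@[a] = h.@[fun i => 0 * a i].
    by apply: meval_eq => i; rewrite mul0r (dotvv_eq0 a0).
  by rewrite (meval_homogZ _ _ hh) a0 !expr0n muln_eq0 /= (gtn_eqF n0) mul0r normr0 mulr0.
have r0 : Num.sqrt (dotv a a) != 0 by rewrite sqrtr_eq0 -ltNge lt_def anz dotvv_ge0.
have -> : h.@[a] = h.@[fun i => Num.sqrt (dotv a a) * ((Num.sqrt (dotv a a))^-1 * a i)].
  by apply: meval_eq => i; rewrite mulVKf.
rewrite (meval_homogZ _ _ hh) exprM sqr_sqrtr ?dotvv_ge0 // normrM ger0_norm ?exprn_ge0 ?dotvv_ge0 //.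
rewrite mulrC ler_wpM2r ?exprn_ge0 ?dotvv_ge0 // hS // /unit_sphere.
under eq_bigr do rewrite exprMn.
by rewrite -mulr_sumr -aE exprVn sqr_sqrtr ?dotvv_ge0 // mulVf.
Qed.

End LinePolynomial.

(** * Reflection in a line and the second-order estimate *)

Section Reflection.
Variables (R : realType) (d : nat).
Implicit Types (x y u v : 'I_d -> R).

(** The isometry that fixes the line of the unit vector x and is -1 on its
    orthogonal. *)
Definition axis_refl x y : 'I_d -> R := fun i => 2 * dotv x y * x i - y i.

Lemma dotv_lincomb u v z (a b : R) :
  dotv u (fun i => a * v i + b * z i) = a * dotv u v + b * dotv u z.
Proof.
rewrite /dotv !mulr_sumr -big_split /=; apply: eq_bigr => i _; ring.
Qed.

Lemma dotv_reflr x u v : dotv u (axis_refl x v) = 2 * dotv x v * dotv u x - dotv u v.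
Proof.
rewrite -[- dotv u v]mulN1r -dotv_lincomb.
by apply: eq_bigr => i _; rewrite mulN1r.
Qed.

Lemma dotv_refl_adj x u v : dotv (axis_refl x u) v = dotv u (axis_refl x v).
Proof.
by rewrite dotvC !dotv_reflr (dotvC v x) (dotvC v u) (dotvC u x); ring.
Qed.

Lemma axis_refl_isometry x u v : dotv x x = 1 ->
  dotv (axis_refl x u) (axis_refl x v) = dotv u v.
Proof.
move=> xx; rewrite dotv_refl_adj !dotv_reflr xx (dotvC u x); ring.
Qed.

End Reflection.

(** Write y = t x + s z with s^2 = 1 - t^2 and z a unit vector orthogonal to x.
    The left-hand side splits into the even part at s of u |-> h(t x + u z) minus
    its value at 0, controlled by [even_part_bound], and
    h(t x) - h(x) = (t^(2n) - 1) h(x), controlled by Bernoulli's inequality. *)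
Lemma reflected_mean_bound (R : realType) n : (0 < n)%N -> exists2 c : R, 0 <= c &
  forall d (h : {mpoly R[d]}) (S : R) (x y : 'I_d -> R), h \is (2 * n).-homog ->
    (forall z, unit_sphere z -> `|h.@[z]| <= S) -> unit_sphere x -> unit_sphere y ->
  `|(h.@[y] + h.@[axis_refl x y]) / 2 - h.@[x]| <= c * (1 - dotv x y ^+ 2) * S.
Proof.
move=> n0; have [c c0 cP] := even_part_bound R (2 * n).
exists (c * 2 ^+ n + n%:R); first by rewrite addr_ge0 ?mulr_ge0 ?exprn_ge0.
move=> d h S x y hh hS x1 y1; move tE: (dotv x y) => t.
have /andP[t1 t2] : -1 <= t <= 1 by rewrite -tE; apply: sphere_dotv_bound.
have S0 : 0 <= S by apply: le_trans (hS x x1).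
have s2 : 0 <= 1 - t ^+ 2 by nra.
have [xx yy] := ((unit_sphereE x).1 x1, (unit_sphereE y).1 y1).
pose s := Num.sqrt (1 - t ^+ 2).
have sE : s ^+ 2 = 1 - t ^+ 2 by rewrite sqr_sqrtr.
have s0 : 0 <= s by rewrite sqrtr_ge0.
(* For s = 0 the convention 0^-1 = 0 makes z the zero vector. *)
pose z := fun i => s^-1 * (y i - t * x i).
have szE i : s * z i = y i - t * x i.
  rewrite /z; case: (eqVneq s 0) => [s00|snz]; last by rewrite mulVKf.
  rewrite s00 mul0r; apply/esym.
  apply: (dotvv_eq0 (z := fun i => y i - t * x i)).
  rewrite (_ : dotv _ _ = dotv y y - 2 * t * dotv x y + t ^+ 2 * dotv x x).
    by rewrite xx yy tE; move: sE; rewrite s00 expr0n /=; lra.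
  by rewrite /dotv !mulr_sumr -sumrB -big_split /=; apply: eq_bigr => j _; ring.
have zz : dotv z z <= 1.
  case: (eqVneq s 0) => [s00|snz].
    by rewrite /dotv big1 // => i _; rewrite /z s00 invr0 !mul0r.
  rewrite -(ler_pM2l (_ : 0 < s ^+ 2)) ?exprn_even_gt0 // mulr1.
  rewrite (_ : _ * _ = dotv y y - 2 * t * dotv x y + t ^+ 2 * dotv x x).
    by rewrite xx yy tE sE; lra.
  transitivity (\sum_i (s * z i) * (s * z i)).
    by rewrite /dotv mulr_sumr; apply: eq_bigr => i _; ring.
  rewrite /dotv !mulr_sumr -sumrB -big_split /=; apply: eq_bigr => j _; rewrite szE; ring.
have xz : dotv x z = 0.
  rewrite /z (_ : dotv _ _ = s^-1 * (dotv x y - t * dotv x x)).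
    by rewrite xx tE mulr1 subrr mulr0.
  by rewrite /dotv mulr_sumr -sumrB mulr_sumr; apply: eq_bigr => i _; ring.
pose P := linepoly h (fun i => t * x i) z.
have PB (u : R) : -1 <= u <= 1 -> `|P.[u]| <= S * 2 ^+ n.
  move=> /andP[u1 u2]; rewrite horner_linepoly; apply: le_trans (homog_bound _ n0 hh hS) _.
  rewrite ler_wpM2l // lerXn2r ?nnegrE ?dotvv_ge0 //.
  rewrite (_ : dotv _ _ = t ^+ 2 * dotv x x + 2 * t * u * dotv x z + u ^+ 2 * dotv z z).
    by rewrite xx xz; have := dotvv_ge0 z; nra.
  by rewrite /dotv !mulr_sumr -!big_split /=; apply: eq_bigr => j _; ring.
have := cP P _ (size_linepoly _ _ hh) PB s; rewrite s0 /=.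
have sle1 : s <= 1 by rewrite -(@ler_pXn2r _ 2) ?nnegrE // sE expr1n; nra.
rewrite sle1 => /(_ isT).
have -> : P.[s] = h.@[y].
  by rewrite horner_linepoly; apply: meval_eq => i; rewrite szE; ring.
have -> : P.[- s] = h.@[axis_refl x y].
  rewrite horner_linepoly; apply: meval_eq => i; rewrite mulNr szE /axis_refl tE; ring.
have -> : P.[0] = t ^+ (2 * n) * h.@[x].
  rewrite horner_linepoly -(meval_homogZ _ _ hh).
  by apply: meval_eq => i; rewrite mul0r addr0.
rewrite sE => H1.
have bern k (a : R) : 0 <= a <= 1 -> 0 <= 1 - a ^+ k <= k%:R * (1 - a).
  move=> /andP[a0 a1]; have ak j : 0 <= a ^+ j <= 1 by rewrite exprn_ge0 // exprn_ile1.
  elim: k => [|k /andP[IH1 IH2]]; first by rewrite expr0 subrr mul0r lexx.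
  by have := ak k; rewrite exprSr -natr1; nra.
have H2 : `|t ^+ (2 * n) * h.@[x] - h.@[x]| <= n%:R * (1 - t ^+ 2) * S.
  have /andP[b1 b2] : 0 <= 1 - (t ^+ 2) ^+ n <= n%:R * (1 - t ^+ 2).
    by apply: bern; rewrite sqr_ge0 /=; nra.
  rewrite exprM -{2}[h.@[x]]mul1r -mulrBl normrM distrC (ger0_norm b1).
  by rewrite ler_pM // hS.
set A := _ / 2 in H1 *.
rewrite (_ : A - h.@[x] = (A - t ^+ (2 * n) * h.@[x]) + (t ^+ (2 * n) * h.@[x] - h.@[x])); last by ring.
apply: le_trans (ler_normD _ _) _; move: H1 H2; set X := `|_|; set Y := `|_|.
by move=> H1 H2; lra.
Qed.


(** * The averaging operator of a zonal kernel *)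

Section ZonalOperator.
Variables (R : realType) (d M : nat) (I : finType) (w : I -> R) (y : I -> 'I_d -> R).
Hypothesis cub : sphere_cubature M w y.
Hypothesis d_gt0 : (0 < d)%N.
Implicit Types (x u v : 'I_d -> R) (vs : seq ('I_d -> R)) (phi : {poly R}) (h : {mpoly R[d]}).

(** The Wick recursion only sees scalar products. *)
Lemma smean_isometry (f : ('I_d -> R) -> 'I_d -> R) vs :
  (forall u v, dotv (f u) (f v) = dotv u v) ->
  ~~ odd (size vs) -> (size vs <= 2 * M)%N -> smean w y (map f vs) = smean w y vs.
Proof.
have [_ _ _ wick] := cub => fiso.
elim: {vs}(size vs) {-2}vs (leqnn (size vs)) => [|N IH] vs; first by case: vs.
case: vs => [//|v vs] sN /= ov vM.
have dv : (d + (size vs).-1)%:R != 0 :> R by rewrite pnatr_eq0 -lt0n addn_gt0 d_gt0.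
apply: (mulfI dv); rewrite -{1}(size_map f vs).
rewrite !wick ?size_map //; do ?by move: ov; rewrite negbK.
apply: eq_bigr => k _; rewrite (nth_map (fun=> 0)) // fiso map_del_nth IH ?size_del_nth //.
- by rewrite (leq_trans (leq_pred _)).
- by move: ov; rewrite negbK; case: (size vs) => [|j] //=.
by rewrite (leq_trans (leq_pred _)) // ltnW.
Qed.

(** A monomial as a product of coordinate forms, to which the Wick recursion
    applies. *)
Definition monlist (m : 'X_{1..d}) : seq ('I_d -> R) :=
  flatten [seq nseq (m i) (evec R i) | i <- enum 'I_d].

Lemma size_monlist m : size (monlist m) = mdeg m.
Proof.
rewrite size_flatten /shape -map_comp sumnE big_map mdegE big_enum /=.
by apply: eq_bigr => i _; rewrite size_nseq.
Qed.

Lemma prod_monlist m x : \prod_(u <- monlist m) dotv u x = \prod_i x i ^+ m i.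
Proof.
rewrite big_flatten big_map big_enum /=; apply: eq_bigr => i _.
by rewrite big_nseq iter_mulr_1 dotv_evecl.
Qed.

(** h ranges over functions so that both a form and its composition with a
    reflection can be averaged. *)
Definition zonal_op phi (h : ('I_d -> R) -> R) x : R :=
  \sum_a w a * (phi.[dotv x (y a)] * h (y a)).

Lemma zonal_opE phi h (T : ('I_d -> R) -> 'I_d -> R) x :
  zonal_op phi (fun z => h.@[T z]) x =
  \sum_(m <- msupp h) h@_m * \sum_(k < size phi) phi`_k *
    \sum_a w a * (dotv x (y a) ^+ k * \prod_(u <- monlist m) dotv u (T (y a))).
Proof.
rewrite /zonal_op.
under eq_bigr do rewrite mevalE horner_coef 2!mulr_sumr.
rewrite exchange_big /=; apply: eq_bigr => m _; rewrite mulr_sumr.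
under [RHS]eq_bigr do rewrite !mulr_sumr.
rewrite exchange_big /=; apply: eq_bigr => a _.
rewrite prod_monlist mulr_suml mulr_sumr; apply: eq_bigr => k _; ring.
Qed.

Variables (phi : {poly R}) (n : nat).
Hypothesis phi_even : forall k, odd k -> phi`_k = 0.
Hypothesis phi_size : (size phi + 2 * n <= (2 * M).+1)%N.
Hypothesis phi_ge0 : forall t, 0 <= phi.[t].
Hypothesis phi_mass : zmean d phi = 1.

Lemma zonal_op_refl x h : unit_sphere x -> h \is (2 * n).-homog ->
  zonal_op phi (fun z => h.@[axis_refl x z]) x = zonal_op phi (fun z => h.@[z]) x.
Proof.
move=> x1 /dhomogP hh; have xx := (unit_sphereE x).1 x1.
rewrite (zonal_opE _ _ (axis_refl x)) (zonal_opE _ _ id); apply: eq_big_seq => m mh.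
congr (_ * _); apply: eq_bigr => k _.
case: (boolP (odd k)) => ok; first by rewrite phi_even // !mul0r.
congr (_ * _); have smE f : smean w y (map f (nseq k x ++ monlist m)) =
   \sum_a w a * (dotv (f x) (y a) ^+ k * \prod_(u <- monlist m) dotv (f u) (y a)).
  apply: eq_bigr => a _; congr (_ * _); rewrite map_cat big_cat /= map_nseq big_nseq iter_mulr_1.
  by rewrite big_map.
have := smE id; rewrite map_id => <-.
have szm : size (monlist m) = (2 * n)%N by rewrite size_monlist -(hh _ mh).
rewrite -(smean_isometry (f := axis_refl x)).
- rewrite smE; apply: eq_bigr => a _; rewrite dotv_refl_adj dotv_reflr xx.
  rewrite (_ : 2 * _ * 1 - _ = dotv x (y a)); last by ring.
  by do 2 congr (_ * _); apply: eq_bigr => u _; rewrite dotv_refl_adj.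
- by move=> u v; apply: axis_refl_isometry.
- by rewrite size_cat size_nseq szm oddD (negPf ok) mul2n odd_double.
by rewrite size_cat size_nseq szm -ltnS (leq_trans _ phi_size) // ltn_add2r.
Qed.

Lemma zmean_cubature (psi : {poly R}) x : unit_sphere x -> (forall k, odd k -> psi`_k = 0) ->
  (size psi <= (2 * M).+1)%N -> zmean d psi = \sum_a w a * psi.[dotv x (y a)].
Proof.
move=> x1 pe sp; rewrite /zmean.
under [RHS]eq_bigr do rewrite horner_coef mulr_sumr.
rewrite exchange_big /=; apply: eq_bigr => k _.
case: (boolP (odd k)) => ok.
  by rewrite pe // mul0r big1 // => a _; rewrite mul0r mulr0.
rewrite -(sphere_moment d_gt0 cub x1 ok); last by rewrite -ltnS (leq_trans _ sp).
by rewrite mulr_sumr; apply: eq_bigr => a _; ring.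
Qed.

(** Averaging h and its reflection with the same kernel cancels the first-order
    term, and phi >= 0 lets the pointwise bound be averaged. *)
Lemma zonal_op_close c h S x : (0 < n)%N -> 
  (forall x z, unit_sphere x -> unit_sphere z ->
    `|(h.@[z] + h.@[axis_refl x z]) / 2 - h.@[x]| <= c * (1 - dotv x z ^+ 2) * S) ->
  h \is (2 * n).-homog -> unit_sphere x ->
  `|zonal_op phi (fun z => h.@[z]) x - h.@[x]| <= c * zmean d ((1 - 'X^2) * phi) * S.
Proof.
move=> n0 hS hh x1; have [w0 y1 _ _] := cub.
have -> : zonal_op phi (fun z => h.@[z]) x - h.@[x] =
  \sum_a w a * (phi.[dotv x (y a)] * ((h.@[y a] + h.@[axis_refl x (y a)]) / 2 - h.@[x])).
  have -> : zonal_op phi (fun z => h.@[z]) x =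
    \sum_a w a * (phi.[dotv x (y a)] * ((h.@[y a] + h.@[axis_refl x (y a)]) / 2)).
    transitivity (2^-1 * (zonal_op phi (fun z => h.@[z]) x + zonal_op phi (fun z => h.@[axis_refl x z]) x)).
      by rewrite zonal_op_refl //; field.
    by rewrite /zonal_op -big_split mulr_sumr; apply: eq_bigr => a _ /=; field.
  have mass : \sum_a w a * phi.[dotv x (y a)] = 1.
    by rewrite -zmean_cubature // (leq_trans _ phi_size) // leq_addr.
  rewrite -[X in _ - X = _]mul1r -mass.
  by rewrite mulr_suml -sumrB; apply: eq_bigr => a _; ring.
apply: le_trans (ler_norm_sum _ _ _) _.
rewrite (zmean_cubature x1); first last.
- have -> : (1 - 'X^2 : {poly R}) = - ('X^2 - 1%:P) by rewrite opprB.
  rewrite (leq_trans (size_polyMleq _ _)) // size_polyN size_XnsubC //=.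
  by rewrite (leq_trans _ phi_size) // [leqLHS]addnC leq_add2l leq_pmulr.
- move=> k ok; rewrite mulrBl mul1r coefB coefXnM phi_even //; case: ifP => k2; rewrite ?subr0 //.
  by rewrite phi_even ?subr0 // oddB ?ok // leqNgt k2.
rewrite mulr_sumr mulr_suml; apply: ler_sum => a _.
have p0 := phi_ge0 (dotv x (y a)).
rewrite normrM (ger0_norm (w0 a)) normrM (ger0_norm p0) hornerM.
have -> : (1 - 'X^2 : {poly R}).[dotv x (y a)] = 1 - dotv x (y a) ^+ 2 by rewrite !hornerE.
have B := ler_wpM2l (mulr_ge0 (w0 a) p0) (hS x (y a) x1 (y1 a)).
rewrite [leLHS]mulrA; apply: (le_trans B).
rewrite le_eqVlt; apply/orP; left; apply/eqP; ring.
Qed.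

End ZonalOperator.

(** * Polynomials on the sphere *)

Section Vanishing.
Variables (R : realType) (d : nat).
Implicit Types (p f : {mpoly R[d]}).

Lemma mderiv_eq0_const p : (forall i, p^`M(i) = 0) -> p = (p@_0)%:MP.
Proof.
move=> p0; apply/mpolyP => m; rewrite mcoeffC.
case: (eqVneq m 0%MM) => [->|mnz]; first by rewrite mulr1.
rewrite mulr0.
have [i mi] : exists i, (0 < m i)%N.
  apply/existsP; rewrite -[[exists _, _]]negbK negb_exists; apply: contra mnz => /forallP H.
  by apply/eqP/mnmP => i; rewrite mnm0E; have := H i; case: (m i).
have mE : (m - U_(i) + U_(i))%MM = m.
  by rewrite submK //; rewrite lep1mP -lt0n.
have := mcoeff_deriv i (m - U_(i)) p; rewrite p0 mcoeff0 mE => /esym/eqP.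
by rewrite mulrn_eq0 => /eqP.
Qed.

Lemma msize_mderiv_le i p k : (msize p <= k.+1)%N -> (msize p^`M(i) <= k)%N.
Proof.
move=> pk; apply: contraTT isT; rewrite -ltnNge => kp.
have dnz : p^`M(i) != 0 by apply: contraTneq kp => ->; rewrite msize0.
have := mlead_supp dnz; rewrite mcoeff_msupp mcoeff_deriv mulrn_eq0 /= -mcoeff_msupp.
move=> /msize_mdeg_lt; rewrite mdegD mdeg1 addn1 (mlead_deg dnz) => H.
by have := leq_trans H pk; rewrite ltnS leqNgt kp.
Qed.

Lemma msizeM_leq p f : (msize (p * f) <= (msize p + msize f).-1)%N.
Proof.
case: (eqVneq p 0) => [->|pnz]; first by rewrite mul0r msize0.
case: (eqVneq f 0) => [->|fnz]; first by rewrite mulr0 msize0.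
by rewrite msizeM.
Qed.

(** A polynomial that vanishes everywhere is orthogonal to every polynomial for
    the Gaussian mean.  By Stein's identity its partial derivatives inherit this
    property, and a constant orthogonal to 1 is 0. *)
Lemma meval_eq0 p : (forall v, p.@[v] = 0) -> p = 0.
Proof.
move=> p0; have [w [t [w0 w1 wS]]] := hermite_quadrature R (2 * msize p).
pose E (q : {mpoly R[d]}) : R := \sum_a pweight w a * q.@[pnode t a].
have stein i q : (msize q <= (2 * msize p).+1)%N -> E ('X_i * q) = E q^`M(i).
  exact: pmean_stein.
have ED q1 q2 : E (q1 + q2) = E q1 + E q2.
  by rewrite /E -big_split; apply: eq_bigr => a _; rewrite mevalD mulrDr.
suff H k q : (k <= msize p)%N -> (msize q <= k)%N ->
    (forall f, (msize f <= k)%N -> E (q * f) = 0) -> q = 0.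
  apply: (H (msize p)) => // f _; rewrite /E big1 // => a _.
  by rewrite mevalM p0 mul0r mulr0.
elim: k q => [|k IH] q kp qk qE; first by apply/eqP; rewrite -msize_poly_eq0 -leqn0.
have dq0 i : q^`M(i) = 0.
  apply: IH (ltnW kp) (msize_mderiv_le i qk) _ => f fk.
  have := stein i (q * f); rewrite mderivM ED mulrCA qE; last first.
    exact: leqW (msize_mderiv_le i (leqW fk)).
  rewrite qE ?addr0; last first.
    by rewrite (leq_trans (msizeM_leq _ _)) // msizeX mdeg1 /=.
  move=> <- //; rewrite (leq_trans (msizeM_leq _ _)) //.
  by move: kp qk fk; move: (msize q) (msize f) (msize p) => *; lia.
have qC := mderiv_eq0_const dq0.
have := qE 1; rewrite msize1 mulr1 qC => /(_ isT).
rewrite /E; under eq_bigr do rewrite mevalC.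
rewrite -mulr_suml /pweight -(bigA_distr_bigA (fun _ : 'I_d => w)) /= big1 // mul1r => ->.
by rewrite mpolyC0.
Qed.

Lemma homog_eq0_on_sphere n p : (0 < n)%N -> p \is (2 * n).-homog ->
  (forall x, unit_sphere x -> p.@[x] = 0) -> p = 0.
Proof.
move=> n0 hp p0; apply: meval_eq0 => v; apply/eqP; rewrite -normr_le0.
rewrite -(mul0r (dotv v v ^+ n)); apply: homog_bound => // x x1.
by rewrite p0 // normr0.
Qed.

Lemma sphere_sup p : (0 < d)%N -> exists S : R, (forall x, unit_sphere x -> `|p.@[x]| <= S) /\
  forall B, (forall x, unit_sphere x -> `|p.@[x]| <= B) -> S <= B.
Proof.
move=> d0; pose A := [set r | exists2 x : 'I_d -> R, unit_sphere x & r = `|p.@[x]|]%classic.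
have A0 : (A !=set0)%classic.
  exists `|p.@[evec R (Ordinal d0)]|; exists (evec R (Ordinal d0)) => //.
  by rewrite unit_sphereE dotv_evecl /evec eqxx.
have Aub : has_ubound A.
  exists (\sum_(m <- msupp p) `|p@_m|) => _ [x x1 ->].
  rewrite mevalE (le_trans (ler_norm_sum _ _ _)) //; apply: ler_sum => m _.
  rewrite normrM ler_piMr // normr_prod; apply: prodr_ile1 => i _.
  rewrite normr_ge0 normrX exprn_ile1 // -(@ler_pXn2r _ 2) ?nnegrE // expr1n real_normK ?num_real //.
  rewrite -x1 (bigD1 i) //= lerDl sumr_ge0 // => j _; exact: sqr_ge0.
exists (sup A); split=> [x x1|B hB].
  by apply: ub_le_sup => //; exists x.
by apply: ge_sup => // _ [x x1 ->]; apply: hB.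
Qed.

End Vanishing.

(** * The averaging operator as an operator on forms *)

Section LinearInverse.
Variables (R : realType) (d e : nat).
Variable K : {mpoly R[d]} -> {mpoly R[d]}.
Hypothesis K_linear : forall c p q, K (c *: p + q) = c *: K p + K q.
Hypothesis K_homog : forall p, p \is e.-homog -> K p \is e.-homog.
Hypothesis K_inj : forall p, p \is e.-homog -> K p = 0 -> p = 0.

(** The space of forms of degree e has finite dimension. *)
Lemma homog_endo_surj f : (0 < d)%N -> f \is e.-homog -> exists2 h, h \is e.-homog & K h = f.
Proof.
case: d K K_linear K_homog K_inj f => // d' K' Klin Khom Kinj f _ hf.
pose V := dhomog d'.+1 R e.
pose KV (h : V) : V := DHomog (Khom _ (dhomog_is_dhomog h)).
have KVlin : linear KV by move=> c p q; apply/val_inj; rewrite /= Klin.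
pose KVM := GRing.isLinear.Build _ _ _ _ KV KVlin.
pose KVL : {linear V -> V} := HB.pack KV KVM.
have ker0 : lker (linfun KVL) == 0%VS.
  apply/lker0P => p q; rewrite !lfunE /= => /(congr1 val) /= pq.
  apply/eqP; rewrite -subr_eq0; apply/eqP/val_inj/Kinj => /=.
    by rewrite rpredB // dhomog_is_dhomog.
  by rewrite -scaleN1r addrC Klin pq scaleN1r addNr.
exists ((linfun KVL)^-1%VF (DHomog hf)) => /=; first exact: dhomog_is_dhomog.
by have := lker0_lfunVK ker0 (DHomog hf); rewrite lfunE => /(congr1 val).
Qed.
End LinearInverse.

Section ZonalPolynomials.
Variables (R : realType) (d : nat).
Implicit Types (x u v : 'I_d -> R) (vs : seq ('I_d -> R)).

Definition norm2poly : {mpoly R[d]} := \sum_i 'X_i ^+ 2.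

(** Symbolic Wick recursion: on the sphere, and for j + size vs even, this is
    the mean of <x,y>^j times the product of the <v,y> for v in vs, as a function of x.
    Contracting the head v of the list with one of the j copies of x leaves the
    linear form of v; contracting it with another element of vs lowers the
    degree by 2, which the factor |x|^2 makes up for, so that the result is
    homogeneous of degree size vs.  The first argument only bounds the depth of
    the recursion. *)
Fixpoint zonal_poly (fuel j : nat) vs : {mpoly R[d]} :=
  if vs is v :: us then
    if fuel is s.+1 then
      (d + (j + size us).-1)%:R^-1 *:
        (j%:R *: (linform v * zonal_poly s j.-1 us) +
         \sum_(k < size us) dotv v (nth (fun=> 0) us k) *:
            (norm2poly * zonal_poly s j (del_nth k us)))
    else 0
  else (zmom R d j)%:MP.

Lemma norm2poly_homog : norm2poly \is 2.-homog.
Proof.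
by apply: rpred_sum => i _; rewrite -[2%N]/(1 * 2)%N dhomogMn // dhomogX /= mdeg1.
Qed.

Lemma meval_norm2poly x : unit_sphere x -> norm2poly.@[x] = 1.
Proof.
move=> <-; rewrite raddf_sum /=; apply: eq_bigr => i _.
by rewrite rmorphXn /= mevalXU.
Qed.

Lemma zonal_poly_homog s j vs : (size vs <= s)%N -> zonal_poly s j vs \is (size vs).-homog.
Proof.
elim: s j vs => [|s IH] j [|v us] //=; rewrite ?ltnS => us_s.
- by rewrite -[_%:MP]mulr1 mul_mpolyC rpredZ ?dhomog1.
- by rewrite -[_%:MP]mulr1 mul_mpolyC rpredZ ?dhomog1.
rewrite rpredZ // rpredD //.
  by rewrite rpredZ // -add1n dhomogM // ?linform_homog // IH.
apply: rpred_sum => k _; rewrite rpredZ //.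
have sk := size_del_nth (ltn_ord k).
have -> : (size us).+1 = (2 + size (del_nth k us))%N.
  by rewrite sk add2n prednK // (leq_ltn_trans _ (ltn_ord k)).
by rewrite dhomogM // ?norm2poly_homog // IH // sk (leq_trans (leq_pred _)).
Qed.

Variables (M : nat) (I : finType) (w : I -> R) (y : I -> 'I_d -> R).
Hypothesis cub : sphere_cubature M w y.
Hypothesis d_gt0 : (0 < d)%N.

Lemma zonal_polyE s j vs x : (size vs <= s)%N -> unit_sphere x ->
  ~~ odd (j + size vs) -> (j + size vs <= 2 * M)%N ->
  (zonal_poly s j vs).@[x] = smean w y (nseq j x ++ vs).
Proof.
move=> + x1; elim: s j vs => [|s IH] j [|v us] //=; rewrite ?ltnS => us_s ov jM.
- rewrite addn0 in ov jM; rewrite mevalC cats0 -(sphere_moment d_gt0 cub x1) //.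
  by apply: eq_bigr => a _; rewrite big_nseq iter_mulr_1.
- rewrite addn0 in ov jM; rewrite mevalC cats0 -(sphere_moment d_gt0 cub x1) //.
  by apply: eq_bigr => a _; rewrite big_nseq iter_mulr_1.
have [_ _ _ wick] := cub.
rewrite addnS /= negbK in ov; rewrite addnS in jM.
have sz : size (nseq j x ++ us) = (j + size us)%N by rewrite size_cat size_nseq.
have dn : (d + (j + size us).-1)%:R != 0 :> R by rewrite pnatr_eq0 -lt0n addn_gt0 d_gt0.
rewrite mevalZ; apply: (canLR (mulKf dn)).
have -> : smean w y (nseq j x ++ v :: us) = smean w y (v :: (nseq j x ++ us)).
  by apply: eq_bigr => a _; congr (_ * _); rewrite big_cons !big_cat big_cons /= mulrCA.
rewrite -sz wick ?sz // big_split_ord /= mevalD mevalZ mevalM meval_linform; congr (_ + _).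
  rewrite (eq_bigr (fun=> dotv v x * smean w y (nseq j.-1 x ++ us))); last first.
    move=> k _; have kj := ltn_ord k.
    rewrite nth_cat size_nseq kj nth_nseq kj; congr (_ * smean _ _ _).
    rewrite /del_nth take_cat drop_cat size_nseq kj take_nseq ?(ltnW kj) // drop_nseq.
    case: ltnP => jk; last first.
      have -> : (k.+1 - j = 0)%N by lia.
      have -> : j.-1 = k by lia.
      by rewrite drop0.
    by rewrite catA -nseqD; congr (nseq _ x ++ _); lia.
  rewrite sumr_const card_ord -[RHS]mulr_natl; case: (posnP j) => [->|j0].
    by rewrite !mul0r.
  rewrite IH //.
    by move: ov; rewrite -{1}(prednK j0) addSn /=.
  by lia.
rewrite raddf_sum /=; apply: eq_bigr => k _.
rewrite mevalZ mevalM meval_norm2poly // mul1r nth_cat size_nseq ltnNge leq_addr /= addKn.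
have sk := size_del_nth (ltn_ord k).
have us0 : (0 < size us)%N by rewrite (leq_ltn_trans _ (ltn_ord k)).
rewrite IH //; first last.
- by rewrite sk; move: jM us0; case: (size us) => *; lia.
- by rewrite sk; move: ov; rewrite -{1}(prednK us0) addnS.
- by rewrite sk (leq_trans (leq_pred _)).
congr (_ * smean _ _ _).
by rewrite /del_nth take_cat drop_cat size_nseq !ltnNge leq_addr /= -addnS leq_addr /= !addKn catA.
Qed.

Variables (phi : {poly R}) (n : nat).
Hypothesis phi_even : forall k, odd k -> phi`_k = 0.
Hypothesis phi_size : (size phi + 2 * n <= (2 * M).+1)%N.

(** Monomials of another degree are sent to 0, so that the operator below is
    linear on all polynomials while taking its values in forms of degree 2n. *)
Definition zonal_mono (m : 'X_{1..d}) : {mpoly R[d]} :=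
  if mdeg m == (2 * n)%N
  then \sum_(k < size phi) phi`_k *: zonal_poly (2 * n) k (monlist R m) else 0.

Definition zonal_endo (h : {mpoly R[d]}) : {mpoly R[d]} :=
  \sum_(m : 'X_{1..d < (2 * n).+1}) h@_m *: zonal_mono m.

Lemma zonal_endo_linear c p q : zonal_endo (c *: p + q) = c *: zonal_endo p + zonal_endo q.
Proof.
rewrite /zonal_endo scaler_sumr -big_split /=; apply: eq_bigr => m _.
by rewrite mcoeffD mcoeffZ scalerDl scalerA.
Qed.

Lemma zonal_endo_homog p : zonal_endo p \is (2 * n).-homog.
Proof.
apply: rpred_sum => m _; rewrite rpredZ // /zonal_mono; case: eqP => [mn|]; last by rewrite rpred0.
apply: rpred_sum => k _; rewrite rpredZ //.
have := @zonal_poly_homog (2 * n) k (monlist R m); rewrite size_monlist mn; exact.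
Qed.

Lemma zonal_endoE p x : p \is (2 * n).-homog -> unit_sphere x ->
  (zonal_endo p).@[x] = zonal_op w y phi (fun z => p.@[z]) x.
Proof.
move=> hp x1.
rewrite /zonal_endo raddf_sum /=.
have mono (m : 'X_{1..d}) : mdeg m = (2 * n)%N ->
   (zonal_mono m).@[x] = zonal_op w y phi (fun z => \prod_i z i ^+ m i) x.
  move=> mn; rewrite /zonal_mono mn eqxx raddf_sum /=.
  transitivity (\sum_(k < size phi) phi`_k * smean w y (nseq k x ++ monlist R m)).
    apply: eq_bigr => k _; rewrite mevalZ; case: (boolP (odd k)) => ok.
      by rewrite phi_even // !mul0r.
    rewrite zonal_polyE // size_monlist mn //.
      by rewrite oddD (negPf ok) mul2n odd_double.
    by rewrite -ltnS (leq_trans _ phi_size) // ltn_add2r.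
  rewrite /zonal_op /smean.
  under eq_bigr do rewrite mulr_sumr.
  rewrite exchange_big /=; apply: eq_bigr => a _.
  rewrite horner_coef mulr_suml mulr_sumr; apply: eq_bigr => k _.
  by rewrite big_cat big_nseq iter_mulr_1 prod_monlist /=; ring.
transitivity (\sum_(m : 'X_{1..d < (2 * n).+1}) p@_m *
    zonal_op w y phi (fun z => \prod_i z i ^+ (m : 'X_{1..d}) i) x).
  apply: eq_bigr => m _; rewrite mevalZ.
  case: (eqVneq (mdeg m) (2 * n)%N) => [mn|mn]; first by rewrite mono.
  by rewrite (dhomog_nemf_coeff hp) ?mul0r.
rewrite /zonal_op.
under eq_bigr do rewrite mulr_sumr.
rewrite exchange_big /=; apply: eq_bigr => a _.
rewrite [in RHS](mpolywE (homog_msize_le hp)) raddf_sum /= !mulr_sumr.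
apply: eq_bigr => m _; rewrite mevalZ mevalX; ring.
Qed.

End ZonalPolynomials.

(** * Positive semidefinite matrices as sums of squares *)

Section PsdDecomposition.
Variables (R : realType) (k : nat).
Implicit Types (A : 'M[R]_k) (u v : 'cV[R]_k).

Let form A u v : R := (u^T *m A *m v) 0 0.

Lemma trmx11E (X : 'M[R]_1) : X^T 0 0 = X 0 0.
Proof. by rewrite mxE. Qed.

Lemma form_lincomb A u v c : A^T = A ->
  form A (u + c *: v) (u + c *: v) = form A u u + 2 * c * form A u v + c ^+ 2 * form A v v.
Proof.
move=> Asym; have fC : form A v u = form A u v.
  by rewrite /form -(trmx11E (u^T *m A *m v)) !trmx_mul trmxK Asym mulmxA.
have -> : form A (u + c *: v) (u + c *: v) =
    ((u^T + c *: v^T) *m A *m (u + c *: v)) 0 0.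
  by rewrite /form; congr ((_ *m _ *m _) _ _); rewrite linearD linearZ.
rewrite !mulmxDl !mulmxDr -!scalemxAl -!scalemxAr.
have mE (X Y : 'M[R]_1) : (X + Y) 0 0 = X 0 0 + Y 0 0 by rewrite mxE.
have zE a (X : 'M[R]_1) : (a *: X) 0 0 = a * X 0 0 by rewrite mxE.
by rewrite !(mE, zE) -/(form A u u) -/(form A u v) -/(form A v u) -/(form A v v) fC; ring.
Qed.

Lemma form_delta A i j : form A (delta_mx i 0) (delta_mx j 0) = A i j.
Proof. by rewrite /form trmx_delta -rowE -colE mxE mxE. Qed.

Lemma form_deltar A u i : form A u (delta_mx i 0) = (u^T *m col i A) 0 0.
Proof. by rewrite /form -mulmxA -colE. Qed.

(** Cholesky elimination: subtracting v v^T, with v a normalized column through a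
    nonzero diagonal entry, keeps the matrix positive semidefinite and clears
    that diagonal entry without creating new ones.  A positive semidefinite
    matrix with zero diagonal is 0. *)
Lemma psd_sum_rank1 A : psdmx A -> exists vs : seq 'cV[R]_k, A = \sum_(v <- vs) v *m v^T.
Proof.
have [N] := ubnP #|[set i | A i i != 0]|; elim: N A => // N IH A NA [Asym Apos].
have diag_ge0 i : 0 <= A i i by rewrite -form_delta; apply: Apos.
case: (boolP [exists i, A i i != 0]) => [/existsP[i Ai]|]; last first.
  rewrite negb_exists => /forallP A0; exists [::]; rewrite big_nil.
  have {}A0 i : A i i = 0 by apply/eqP; have := A0 i; rewrite negbK.
  apply/matrixP => i j; rewrite [RHS]mxE.
  have pos c : 0 <= 2 * c * A i j.
    have := Apos (delta_mx i 0 + c *: delta_mx j 0).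
    rewrite -[X in 0 <= X]/(form A _ _) form_lincomb // !form_delta !A0; lra.
  by have := pos 1; have := pos (-1); lra.
have Ai0 : 0 < A i i by rewrite lt_def Ai diag_ge0.
pose v := (Num.sqrt (A i i))^-1 *: col i A.
have vv : v *m v^T = (A i i)^-1 *: (col i A *m (col i A)^T).
  by rewrite /v linearZ /= -scalemxAl -scalemxAr scalerA -expr2 exprVn sqr_sqrtr.
have vvE p q : (v *m v^T) p q = (A i i)^-1 * (A p i * A q i).
  by rewrite vv !mxE big_ord1 !mxE.
have Bpsd : psdmx (A - v *m v^T).
  split; first by rewrite /symmx linearB /= trmx_mul trmxK Asym.
  move=> u; rewrite mulmxBr mulmxBl [X in 0 <= X]mxE [X in _ + X]mxE.
  set a := (u^T *m col i A) 0 0.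
  have -> : (u^T *m (v *m v^T) *m u) 0 0 = (A i i)^-1 * a ^+ 2.
    rewrite vv -scalemxAr -scalemxAl mxE; congr (_ * _).
    rewrite mulmxA -(mulmxA (u^T *m _)) mxE big_ord1 expr2; congr (_ * _).
    by rewrite /a -(trmx11E (u^T *m _)) trmx_mul trmxK.
  (* This shift of u minimizes the quadratic form along the i-th axis. *)
  have := Apos (u + (- (a / A i i)) *: delta_mx i 0).
  rewrite -[X in 0 <= X]/(form A _ _) form_lincomb // form_delta form_deltar -/a -/(form A u u).
  have -> : form A u u + 2 * - (a / A i i) * a + (- (a / A i i)) ^+ 2 * A i i =
     form A u u - (A i i)^-1 * a ^+ 2 by field.
  by [].
have [|vs Bvs] := IH (A - v *m v^T) _ Bpsd.
  apply: (@leq_trans #|[set i | A i i != 0]|) => //; apply: proper_card; apply/properP; split.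
    apply/subsetP => j; rewrite !inE; apply: contra => /eqP Aj.
    have := Bpsd.2 (delta_mx j 0); rewrite -[X in 0 <= X]/(form _ _ _) form_delta.
    rewrite mxE [X in _ + X]mxE vvE Aj => B0; apply/eqP.
    have : 0 <= (A i i)^-1 * (A j i * A j i) by rewrite mulr_ge0 ?invr_ge0 ?(ltW Ai0) // -expr2 sqr_ge0.
    by lra.
  exists i; rewrite !inE ?Ai //.
  by rewrite mxE [X in _ + X]mxE vvE mulKf // subrr eqxx.
by exists (v :: vs); rewrite big_cons -Bvs addrC subrK.
Qed.

End PsdDecomposition.

Lemma sqr_even_coef (R : comNzRingType) (q : {poly R}) :
  (forall k, odd k -> q`_k = 0) -> forall k, odd k -> (q ^+ 2)`_k = 0.
Proof.
move=> qe k ok; rewrite expr2 coefM big1 // => j _.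
case: (boolP (odd j)) => oj; first by rewrite qe // mul0r.
by rewrite [q`_(k - j)]qe ?mulr0 // oddB ?ok ?(negPf oj) // -ltnS.
Qed.

(** * Inverting the averaging operator *)

Section KernelInverse.
Variables (R : realType) (d n M : nat) (I : finType) (w : I -> R) (y : I -> 'I_d -> R).
Hypotheses (d_gt0 : (0 < d)%N) (n_gt0 : (0 < n)%N).
Hypothesis cub : sphere_cubature M w y.
Variables (phi : {poly R}) (c : R).
Hypothesis phi_even : forall k, odd k -> phi`_k = 0.
Hypothesis phi_size : (size phi + 2 * n <= (2 * M).+1)%N.
Hypothesis phi_ge0 : forall t, 0 <= phi.[t].
Hypothesis phi_mass : zmean d phi = 1.
Hypothesis c_ge0 : 0 <= c.
Hypothesis c_refl : forall (h : {mpoly R[d]}) (S : R) x z, h \is (2 * n).-homog ->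
    (forall z, unit_sphere z -> `|h.@[z]| <= S) -> unit_sphere x -> unit_sphere z ->
  `|(h.@[z] + h.@[axis_refl x z]) / 2 - h.@[x]| <= c * (1 - dotv x z ^+ 2) * S.
Let eta := zmean d ((1 - 'X^2) * phi).
Hypothesis eta_small : c * eta <= 2^-1.

Lemma eta_ge0 : 0 <= eta.
Proof.
apply: zmean_ge0 => // t /andP[t1 t2]; rewrite hornerM mulr_ge0 //.
by rewrite !hornerE; nra.
Qed.

(** If S is the supremum of |h| on the sphere, then S <= B + S / 2 because the
    operator moves h by at most S / 2; hence S <= 2 B. *)
Lemma zonal_inverse_bound (h : {mpoly R[d]}) B x : h \is (2 * n).-homog ->
  (forall z, unit_sphere z -> `|zonal_op w y phi (fun v => h.@[v]) z| <= B) ->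
  unit_sphere x ->
  `|zonal_op w y phi (fun v => h.@[v]) x - h.@[x]| <= 2 * (c * eta) * B.
Proof.
move=> hh hB x1; have [S [hS Smin]] := sphere_sup h d_gt0.
have close z : unit_sphere z -> `|zonal_op w y phi (fun v => h.@[v]) z - h.@[z]| <= c * eta * S.
  move=> z1; apply: (zonal_op_close cub d_gt0 phi_even phi_size phi_ge0 phi_mass n_gt0) => // u v u1 v1.
  exact: c_refl.
have S0 : 0 <= S by apply: le_trans (hS x x1).
have SB : S <= B + 2^-1 * S.
  apply: Smin => z z1; have := close z z1; have := hB z z1.
  set Z := zonal_op _ _ _ _ _ => Z1 Z2.
  have -> : h.@[z] = Z - (Z - h.@[z]) by ring.
  rewrite (le_trans (ler_normB _ _)) // lerD // (le_trans Z2) //.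
  by rewrite ler_wpM2r.
apply: le_trans (close x x1) _.
have ce : 0 <= c * eta by rewrite mulr_ge0 // eta_ge0.
have -> : 2 * (c * eta) * B = c * eta * (2 * B) by ring.
by rewrite ler_wpM2l //; lra.
Qed.

(** The previous bound with B = 0 shows injectivity. *)
Lemma zonal_endo_surj (f : {mpoly R[d]}) : f \is (2 * n).-homog ->
  exists2 h, h \is (2 * n).-homog & zonal_endo phi n h = f.
Proof.
apply: homog_endo_surj => //.
- exact: zonal_endo_linear.
- by move=> p _; apply: zonal_endo_homog.
move=> p hp Kp0; apply: (homog_eq0_on_sphere n_gt0 hp) => x x1.
have K0 z : unit_sphere z -> zonal_op w y phi (fun v => p.@[v]) z = 0.
  by move=> z1; rewrite -(zonal_endoE cub d_gt0 phi_even phi_size) // Kp0 meval0.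
have := @zonal_inverse_bound p 0 x hp; rewrite K0 // mulr0 sub0r normrN => H.
by apply/eqP; rewrite -normr_le0 H // => z z1; rewrite K0 // normr0.
Qed.

End KernelInverse.

(** * Sums of squares of bounded degree *)

Section SosFromCubature.
Variables (R : realType) (d : nat).
Implicit Types (q : {poly R}) (z x : 'I_d -> R).

Definition zonal_form q z : {mpoly R[d]} := \sum_(i < size q) q`_i *: linform z ^+ i.

Lemma meval_zonal_form q z x : (zonal_form q z).@[x] = q.[dotv x z].
Proof.
rewrite raddf_sum horner_coef /=; apply: eq_bigr => i _.
by rewrite mevalZ rmorphXn /= meval_linform dotvC.
Qed.

Lemma msize_zonal_form q z l : (size q <= l.+1)%N -> (msize (zonal_form q z) <= l.+1)%N.
Proof.
move=> ql; apply: leq_trans (msize_sum _ _ _) _; apply/bigmax_leqP => i _.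
apply: leq_trans (msizeZ_le _ _) _.
have := homog_msize_le (dhomogMn i (linform_homog z)); rewrite mul1n => /leq_trans; apply.
by rewrite (leq_trans (ltn_ord i)).
Qed.

Lemma sos_of_positive_mean (k l : nat) (I : finType) (w : I -> R) (y : I -> 'I_d -> R)
    q (A : I -> 'M[R]_k) (G : 'M[{mpoly R[d]}]_k) :
  (0 < k)%N -> (forall a, 0 <= w a) -> (size q <= l.+1)%N -> (forall a, psdmx (A a)) ->
  (forall x, unit_sphere x -> mxeval G x = \sum_a (w a * q.[dotv x (y a)] ^+ 2) *: A a) ->
  sos_on_sphere l G.
Proof.
case: k A G => // k A G _ w0 ql Apsd GE.
have /choice[vs vsE] : forall a, exists vs : seq 'cV[R]_k.+1, A a = \sum_(v <- vs) v *m v^T.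
  by move=> a; apply: psd_sum_rank1.
(* A square matrix with v as its first column and zeros elsewhere has the same
   product with its transpose as the column v. *)
pose U a (v : 'cV[R]_k.+1) : 'M[{mpoly R[d]}]_k.+1 :=
  \matrix_(i, j) (if j == 0 then (Num.sqrt (w a) * v i 0) *: zonal_form q (y a) else 0).
exists (flatten [seq [seq U a v | v <- vs a] | a <- enum I]); split.
  move=> _ /flatten_mapP[a _ /mapP[v _ ->]] i j; rewrite mxE; case: ifP => _.
    exact: leq_trans (msizeZ_le _ _) (msize_zonal_form _ ql).
  by rewrite msize0.
move=> x x1; rewrite GE // big_flatten big_map big_enum /=; apply: eq_bigr => a _.
rewrite big_map vsE scaler_sumr; apply: eq_bigr => v _.
apply/matrixP => i j; rewrite !mxE big_ord1 !mxE big_ord_recl big1 => [|p _].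
  rewrite !mxE /= !mevalZ meval_zonal_form addr0.
  by rewrite -[X in X * _ ^+ 2](sqr_sqrtr (w0 a)); ring.
by rewrite !mxE /= meval0 mul0r.
Qed.

End SosFromCubature.

Section QuadraticForm.
Variables (R : comNzRingType) (k : nat).

Lemma quadform_sum (A : 'M[R]_k) (u : 'cV[R]_k) :
  (u^T *m A *m u) 0 0 = \sum_i \sum_j u i 0 * u j 0 * A i j.
Proof.
rewrite mxE exchange_big /=; apply: eq_bigr => j _.
by rewrite mxE mulr_suml; apply: eq_bigr => i _; rewrite mxE; ring.
Qed.

End QuadraticForm.

Theorem theorem2 (R : realType) (n : nat) (hn : (1 <= n)%N) :
  exists C C' : R, 0 < C /\ 0 < C' /\
    forall (d k : nat) (hd : (n <= d)%N) (hk : (1 <= k)%N)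
      (F : 'M[{mpoly R[d]}]_k),
      symmx F ->
      mx_homog (2 * n) F ->
      (forall x : 'I_d -> R, unit_sphere x ->
         lemx_psd 0 (mxeval F x) /\ lemx_psd (mxeval F x) 1%:M) ->
      forall l : nat, C * d%:R <= l%:R ->
        sos_on_sphere l (F + ((C' * (d%:R / l%:R) ^+ 2)%:MP)%:M).
Proof.
have [c c0 crefl] := reflected_mean_bound R hn.
exists (4 * c + 1), (4 * c + 1); do 2! [split; first by lra].
move=> d k hd hk F Fsym Fhom F01 l Cl.
have d0 : (0 < d)%N := leq_trans hn hd.
have dR : 1 <= d%:R :> R by rewrite ler1n.
have lR : 0 < l%:R :> R by nra.
have l0 : (0 < l)%N by rewrite -(ltr_nat R).
have [q [ql qeven qmass qspread]] := zonal_kernel R d0 l0.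
have [I [w [y cub]]] := sphere_cubature_exists R d0 (ltn_addl l hn).
set r := (d%:R / l%:R) ^+ 2 in qspread *.
pose delta := (4 * c + 1) * r; rewrite -/delta.
have r0 : 0 <= r by rewrite sqr_ge0.
have delta0 : 0 <= delta by rewrite mulr_ge0 //; lra.
have delta1 : delta <= 1.
  rewrite /delta /r exprMn exprVn mulrA ler_pdivrMr ?exprn_gt0 // mul1r.
  have : ((4 * c + 1) * d%:R) ^+ 2 <= l%:R ^+ 2 by rewrite lerXn2r ?nnegrE //; nra.
  by apply: le_trans; rewrite exprMn ler_wpM2r ?sqr_ge0 //; nra.
pose phi := q ^+ 2.
have phi_even : forall j, odd j -> phi`_j = 0 by apply: sqr_even_coef.
have phi_size : (size phi + 2 * n <= (2 * (l + n)).+1)%N.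
  rewrite mulnDr -addSn leq_add2r (leq_trans (size_exp_leq _ _)) // ltnS mulnC leq_mul2l /=.
  by rewrite -subn1 leq_subLR add1n.
have phi_ge0 t : 0 <= phi.[t] by rewrite horner_exp sqr_ge0.
have eta0 := eta_ge0 d0 phi_ge0.
(* With l >= (4 c + 1) d, the kernel satisfies c eta <= 2 c r <= 1/2. *)
have ceta : c * zmean d ((1 - 'X^2) * phi) <= 2^-1.
  by apply: le_trans (ler_wpM2l c0 qspread) _; rewrite /delta in delta1; lra.
have creflF := crefl d.
(* The preimages are chosen by a function of the entry, so that H inherits the
   symmetry of F. *)
have [H HF] : {H : 'M[{mpoly R[d]}]_k | H^T = H /\
    forall i j, H i j \is (2 * n).-homog /\ zonal_endo phi n (H i j) = F i j}.
  have /choice[g gP] : forall f : {mpoly R[d]}, exists h, f \is (2 * n).-homog ->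
      h \is (2 * n).-homog /\ zonal_endo phi n h = f.
    move=> f; case: (boolP (f \is (2 * n).-homog)) => hf; last by exists 0.
    have [h hh hK] := zonal_endo_surj d0 hn cub phi_even phi_size phi_ge0 qmass c0 creflF ceta hf.
    by exists h.
  exists (map_mx g F); split; first by rewrite map_trmx Fsym.
  by move=> i j; rewrite mxE; apply: gP.
have [Hsym HP] := HF.
have [w0 y1 w1 _] := cub.
apply: (@sos_of_positive_mean _ _ _ _ _ w y q (fun a => mxeval H (y a) + delta%:M)) => //.
(* For fixed u, the scalar form u^T F u lies between 0 and |u|^2, and its preimage
   u^T H u is within delta |u|^2 of it. *)
- move=> a; split.
    by rewrite /symmx linearD /= tr_scalar_mx /mxeval map_trmx Hsym.
  move=> u; pose h := \sum_i \sum_j (u i 0 * u j 0) *: H i j.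
  pose f := \sum_i \sum_j (u i 0 * u j 0) *: F i j.
  pose B := \sum_i u i 0 ^+ 2.
  have hh : h \is (2 * n).-homog.
    by apply: rpred_sum => i _; apply: rpred_sum => j _; rewrite rpredZ //; case: (HP i j).
  have Kh x : unit_sphere x -> zonal_op w y phi (fun v => h.@[v]) x = f.@[x].
    move=> x1; rewrite /zonal_op /h /f !raddf_sum /=.
    transitivity (\sum_i \sum_j u i 0 * u j 0 * zonal_op w y phi (fun v => (H i j).@[v]) x).
      rewrite /zonal_op.
      under [RHS]eq_bigr do under eq_bigr do rewrite mulr_sumr.
      under [RHS]eq_bigr do rewrite exchange_big.
      rewrite [RHS]exchange_big /=; apply: eq_bigr => b _.
      rewrite raddf_sum /= !mulr_sumr; apply: eq_bigr => i _.
      rewrite raddf_sum /= !mulr_sumr; apply: eq_bigr => j _.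
      by rewrite mevalZ; ring.
    apply: eq_bigr => i _; rewrite raddf_sum /=; apply: eq_bigr => j _.
    have [hij Kij] := HP i j.
    by rewrite -(zonal_endoE cub d0 phi_even phi_size) // Kij mevalZ.
  have form_h x : (u^T *m mxeval H x *m u) 0 0 = h.@[x].
    rewrite quadform_sum /h raddf_sum /=; apply: eq_bigr => i _.
    by rewrite raddf_sum /=; apply: eq_bigr => j _; rewrite mevalZ mxE.
  have form_f x : (u^T *m mxeval F x *m u) 0 0 = f.@[x].
    rewrite quadform_sum /f raddf_sum /=; apply: eq_bigr => i _.
    by rewrite raddf_sum /=; apply: eq_bigr => j _; rewrite mevalZ mxE.
  have form_1 e : (u^T *m (e%:M) *m u) 0 0 = e * B.
    rewrite mul_mx_scalar -scalemxAl mxE [X in _ * X]mxE; congr (_ * _).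
    by apply: eq_bigr => i _; rewrite mxE expr2.
  have f0B x : unit_sphere x -> 0 <= f.@[x] <= B.
    move=> x1; have [[_ F0] [_ F1]] := F01 x x1; apply/andP; split.
      by have := F0 u; rewrite subr0 form_f.
    have := F1 u; rewrite mulmxBr mulmxBl mxE [X in _ + X]mxE form_f form_1 mul1r.
    by rewrite subr_ge0.
  have KB x : unit_sphere x -> `|zonal_op w y phi (fun v => h.@[v]) x| <= B.
    by move=> x1; rewrite Kh //; have /andP[f0 fB] := f0B x x1; rewrite ger0_norm.
  have := zonal_inverse_bound d0 hn cub phi_even phi_size phi_ge0 qmass c0 (creflF) ceta hh KB (y1 a).
  rewrite Kh ?y1 // ler_norml => /andP[_ hlow].
  have /andP[f0 fB] := f0B _ (y1 a).
  have B0 : 0 <= B := le_trans f0 fB.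
  rewrite mulmxDr mulmxDl mxE form_h form_1.
  have : 2 * (c * zmean d ((1 - 'X^2) * phi)) * B <= delta * B.
    rewrite ler_wpM2r // /delta; have := ler_wpM2l c0 qspread; rewrite -/phi; lra.
  lra.
move=> x x1; apply/matrixP => i j; rewrite summxE !mxE.
have [hij Kij] := HP i j.
have mass : \sum_a w a * phi.[dotv x (y a)] = 1.
  by rewrite -(zmean_cubature cub d0 x1 phi_even) // (leq_trans _ phi_size) // leq_addr.
rewrite mevalD mevalMn mevalC -Kij (zonal_endoE cub d0 phi_even phi_size) //.
rewrite -[delta *+ _]mul1r -mass mulr_suml /zonal_op -big_split; apply: eq_bigr => a _.
by rewrite !mxE /phi horner_exp /=; ring.
Qed.
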